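(* Let $\Lambda_3=\{v\in[0,1]^3: v_1+v_2+v_3=1\}$ and let $\mathbf{p}:\mathbb{Z}\to\Lambda_3$ be an ergodic random field. For each $n$, let $K=K^{(n)}$ be the random birth-and-death (tridiagonal) Markov kernel on $\{1,\dots,n\}$ with $$K_{i,i+1}=b_i,\quad K_{i,i}=a_i,\quad K_{i,i-1}=c_i$$ and all other entries zero, where for every $1\le i\le n$ $$(c_i,a_i,b_i)=\begin{cases}\mathbf{p}(i)&\text{if }2\le i\le n-1\\ \mathbf{p}(1)_+&\text{if }i=1\\ \mathbf{p}(n)_-&\text{if }i=n,\end{cases}$$ with $v_-=(v_1+v_3,v_2,0)$ and $v_+=(0,v_2,v_1+v_3)$ for $v\in\Lambda_3$. Let $\mu_K=\frac1n\sum_{k=1}^n\delta_{\lambda_k(K)}$ be the empirical distribution of the eigenvalues of $K$. Then there exists a non-random probability measure $\mu$ on $[-1,+1]$ such that almost surely $$\lim_{n\to\infty}W_p(\mu_K,\mu)=0\quad\text{for every }p\ge1.$$ Moreover, for every integer $\ell\ge0$, $$\int_{-1}^{+1}x^\ell\,\mu(dx)=\mathbb{E}[r_\ell^{\mathbf p}(0)],$$ where $r_\ell^{\mathbf p}(0)$ is the probability of return to $0$ in $\ell$ steps for the random walk on $\mathbb{Z}$ in the random environment $\mathbf{p}$, and the expectation is taken with respect to the environment $\mathbf{p}$.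
   Context: An ergodic random field $\mathbf p=(\mathbf p(i))_{i\in\mathbb{Z}}$ is a random sequence whose law is stationary and ergodic with respect to the shift on $\mathbb{Z}$. For a fixed realization of $\mathbf p$, the random walk on $\mathbb{Z}$ in environment $\mathbf p$ is the Markov chain which from $i$ jumps to $i-1$, stays at $i$, or jumps to $i+1$ with respective probabilities $\mathbf p(i)_1$, $\mathbf p(i)_2$, $\mathbf p(i)_3$; $r^{\mathbf p}_\ell(0)$ is the probability that this chain started at $0$ is at $0$ at time $\ell$. The eigenvalues $\lambda_1(K),\dots,\lambda_n(K)$ of the tridiagonal stochastic matrix $K$ (counted with algebraic multiplicity) are real and lie in $[-1,1]$. For real $p\ge1$ and probability measures $\mu,\nu$ on $\mathbb{R}$, the Wasserstein distance is $W_p(\mu,\nu)=\inf_\Pi\left(\int_{\mathbb{R}\times\mathbb{R}}|x-y|^p\,\Pi(dx,dy)\right)^{1/p}$, the infimum being over all probability measures $\Pi$ on $\mathbb{R}^2$ with marginals $\mu$ and $\nu$. *)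

(* Defs.v *)
From HB Require Import structures.
From mathcomp Require Import all_boot all_order all_algebra.
From mathcomp Require Import polyrcf.
From mathcomp Require Import all_classical all_reals all_analysis.

Set Implicit Arguments.
Unset Strict Implicit.
Unset Printing Implicit Defensive.

Import Order.TTheory GRing.Theory Num.Theory.
Import numFieldNormedType.Exports.

Local Open Scope classical_set_scope.
Local Open Scope ring_scope.

(* The coordinates v_1, v_2, v_3 of a triple v are written v`_0, v`_1, v`_2. *)
Definition Lambda3 (R : realType) : set (3.-tuple R) :=
  [set v | (forall k : 'I_3, 0 <= tnth v k <= 1) /\ v`_0 + v`_1 + v`_2 = 1].

Definition vminus (R : realType) (v : 3.-tuple R) : 3.-tuple R :=
  [tuple v`_0 + v`_2; v`_1; 0].

Definition vplus (R : realType) (v : 3.-tuple R) : 3.-tuple R :=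
  [tuple 0; v`_1; v`_0 + v`_2].

(* The space of environments, with the product sigma-algebra, i.e. the one     *)
(* generated by the evaluations at the sites of Z.                             *)
Definition cylinders (R : realType) :
    set (set (int -> 3.-tuple (measurableTypeR R))) :=
  \bigcup_(i in [set: int])
    preimage_set_system setT
      (fun e : int -> 3.-tuple (measurableTypeR R) => e i) measurable.

Notation env R := (g_sigma_algebraType (@cylinders R)).

Definition shift_env (R : realType) (e : env R) : env R := fun i => e (i + 1).

Definition stationary (R : realType) (Q : set (env R) -> \bar R) : Prop :=
  forall A : set (env R), measurable A -> Q (@shift_env R @^-1` A) = Q A.

Definition ergodic (R : realType) (Q : set (env R) -> \bar R) : Prop :=
  forall A : set (env R), measurable A -> @shift_env R @^-1` A = A ->
    Q A = 0%E \/ Q A = 1%E.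

Definition ergodic_random_field (d : measure_display) (Omega : measurableType d)
    (R : realType) (P : probability Omega R) (p : {RV P >-> env R}) : Prop :=
  [/\ forall w i, Lambda3 (p w i),
      stationary (distribution P p) & ergodic (distribution P p)].

(* For n = 1 the two boundary cases coincide; in both readings K is then the   *)
(* 1 x 1 matrix with entry a_1 = p(1)_2.                                       *)
Definition site_probs (R : realType) (e : env R) (n i : nat) : 3.-tuple R :=
  if i == 1%N then vplus (e 1)
  else if i == n then vminus (e n%:Z)
  else e i%:Z.

(* The ordinal i : 'I_n stands for the state i.+1 of {1, ..., n}.              *)
Definition bd_kernel (R : realType) (e : env R) (n : nat) : 'M[R]_n :=
  \matrix_(i < n, j < n)
    let v := site_probs e n i.+1 in
    if j == i.+1 :> nat then v`_2
    else if j == i :> nat then v`_1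
    else if j.+1 == i :> nat then v`_0
    else 0.

(* Real eigenvalues, each repeated according to its algebraic multiplicity.    *)
(* This is the whole spectrum as soon as the characteristic polynomial splits  *)
(* over R, which is the case for tridiagonal stochastic matrices.              *)
Definition eigenvalues (R : realType) (n : nat) (A : 'M[R]_n) : seq R :=
  flatten [seq nseq (mup x (char_poly A)) x | x <- rootsR (char_poly A)].

Section empirical_distribution.
Variables (R : realType) (n : nat) (A : 'M[R]_n.+1).

Definition empirical_distribution : set (measurableTypeR R) -> \bar R :=
  mscale (n.+1%:R^-1)%:nng
    (msum (fun k => \d_((eigenvalues A)`_k : measurableTypeR R)) n.+1).

HB.instance Definition _ := Measure.on empirical_distribution.

Let empirical_distributionT : empirical_distribution setT = 1%E.
Proof.
rewrite /empirical_distribution /= /mscale /= /msum.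
rewrite (eq_bigr (fun=> 1%E)) => [|k _]; last exact: diracT.
rewrite sumEFin big_const_ord iter_addr_0 -EFinM.
by congr (_%:E); rewrite mulVf.
Qed.

HB.instance Definition _ :=
  Measure_isProbability.Build _ _ R empirical_distribution
    empirical_distributionT.

End empirical_distribution.

Definition coupling (R : realType) (mu nu : probability (measurableTypeR R) R)
    (Pi : probability (measurableTypeR R * measurableTypeR R)%type R) : Prop :=
  forall A : set (measurableTypeR R), measurable A ->
    Pi (fst @^-1` A) = mu A /\ Pi (snd @^-1` A) = nu A.

Definition wasserstein (R : realType) (q : R)
    (mu nu : probability (measurableTypeR R) R) : \bar R :=
  ereal_inf [set ((\int[Pi]_z (`|z.1 - z.2| `^ q)%:E) `^ q^-1)%E
            | Pi in coupling mu nu].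

(* Quenched random walk in the environment e.                                  *)
Definition walk_step (R : realType) (e : env R) (i j : int) : R :=
  if j == i - 1 then (e i)`_0
  else if j == i then (e i)`_1
  else if j == i + 1 then (e i)`_2
  else 0.

(* walk_law e l j is the probability that the walk started at 0 is at j at     *)
(* time l; the sites j - 1, j, j + 1 are the only ones from which the walk can *)
(* jump to j.                                                                  *)
Fixpoint walk_law (R : realType) (e : env R) (l : nat) (j : int) : R :=
  if l is l'.+1 then
    \sum_(i <- [:: j - 1; j; j + 1]) walk_law e l' i * walk_step e i j
  else (j == 0)%:R.

Definition return_prob (R : realType) (e : env R) (l : nat) : R :=
  walk_law e l 0.

(* Main.v *)
Require Import Defs.
From HB Require Import structures.
From mathcomp Require Import all_boot all_order all_algebra.
From mathcomp Require Import polyrcf complex.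
From mathcomp Require Import all_classical all_reals all_analysis.
From mathcomp Require Import measurable_realfun ring lra zify.

Set Implicit Arguments.
Unset Strict Implicit.
Unset Printing Implicit Defensive.

Import Order.TTheory GRing.Theory Num.Theory.
Import numFieldNormedType.Exports.

Local Open Scope classical_set_scope.
Local Open Scope ring_scope.

(** Moments, then quantiles.

    The l-th moment of the empirical spectral distribution of K is
    n^-1 tr K^l. A path of length l started at distance at least l from both
    ends of the segment does not see the boundary, so the diagonal entry of K^l
    at such a site is the return probability of the walk in the environment
    seen from that site; only 2l sites are exceptional
    ([trace_return_prob]). The normalized trace is therefore a Birkhoff average
    along the shift, and it converges almost surely to the mean return
    probability by the pointwise ergodic theorem ([birkhoff]), which is
    deduced here from the maximal ergodic inequality. Hence almost surely all
    the empirical moments converge to deterministic numbers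
    ([eigenvalue_moments]).

    This requires the list of real eigenvalues to carry the whole spectrum
    ([tridiag_spectrum]). The characteristic polynomial of a tridiagonal matrix
    with b_i c_(i+1) >= 0 obeys a three-term recurrence whose Wronskian-like
    quantity has positive imaginary part in the upper half-plane
    ([Im_det_tridiag_gt0]), so all its complex roots are real; a Schur
    triangularization over the complex numbers then identifies tr K^l with the
    sum of the l-th powers of the roots. The roots lie in [-1, 1] because K is
    (sub)stochastic.

    Convergence of moments is upgraded to convergence in Wasserstein distance
    through quantile functions. Polynomials approximate the ramps that equal 1
    left of a and 0 right of b, so the empirical mean of each ramp has a
    deterministic limit L a b ([mean_approx_cvg]). Comparing this limit with t
    tells whether the quantile of order t is eventually at least a or
    eventually at most b, as soon as t <> L a b; discarding the countably many
    values of L at rational points, the quantile functions converge pointwise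
    to a function determined by L alone ([quantile_cvg]). The limit measure mu
    is the law of that function under the uniform distribution on [0, 1]. The
    quantile functions provide a coupling of the empirical distribution with mu,
    and dominated convergence shows that its L^q cost vanishes ([Lq_cvg]); it
    also identifies the moments of mu. *)

(** * Spectrum of tridiagonal substochastic matrices *)

Lemma char_poly_conj (F : fieldType) n (P A B : 'M[F]_n) :
  P \in unitmx -> P *m A = B *m P -> char_poly A = char_poly B.
Proof.
move=> uP PAB; have dP : (\det P)%:P != 0.
  by rewrite polyC_eq0 -unitfE -unitmxE.
apply: (mulfI dP); rewrite /char_poly -(det_map_mx polyC) [RHS]mulrC -!det_mulmx.
congr (\det _); rewrite /char_poly_mx mulmxBr mulmxBl scalar_mxC -!map_mxM PAB.
by [].
Qed.

Lemma trig_mxX (F : comNzRingType) n (A : 'M[F]_n) l : is_trig_mx A ->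
  is_trig_mx (A ^+ l) /\ forall i, (A ^+ l) i i = A i i ^+ l.
Proof.
move=> /is_trig_mxP tA; elim: l => [|l [/is_trig_mxP IHt IHd]].
  rewrite expr0; split=> [|i]; last by rewrite mxE eqxx expr0.
  by apply/is_trig_mxP => i j ij; rewrite mxE -val_eqE ltn_eqF.
rewrite exprS; split=> [|i]; last first.
  rewrite mxE (bigD1 i)//= IHd big1 ?addr0 -?exprS// => k ki.
  case: (ltngtP k i) => [ki'|ik|/val_inj ik].
  - by rewrite IHt// mulr0.
  - by rewrite tA// mul0r.
  - by rewrite ik eqxx in ki.
apply/is_trig_mxP => i j ij; rewrite mxE big1// => k _.
have [ik|ki] := ltnP i k; first by rewrite tA// mul0r.
by rewrite IHt ?mulr0// (leq_ltn_trans ki).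
Qed.

(** Schur triangularization: conjugation changes neither the characteristic
    polynomial nor the traces of powers, and both are read off the diagonal of a
    triangular matrix. *)
Lemma trace_powers (C : numClosedFieldType) n (A : 'M[C]_n.+1) :
  exists z : seq C, [/\ size z = n.+1,
    char_poly A = \prod_(x <- z) ('X - x%:P) &
    forall l, \tr (A ^+ l) = \sum_(x <- z) x ^+ l].
Proof.
have [//|P /unitarymx_unit uP tB] := @Schur _ n.+1 A.
set B := conjmx P A in tB.
have PAB : P *m A = B *m P by apply: similarPp (stablemx_unit _ uP) _; rewrite /similar_to/=.
have PABl l : P *m A ^+ l = B ^+ l *m P.
  elim: l => [|l IH]; first by rewrite !expr0 mulmx1 mul1mx.
  by rewrite !exprS -!mulmxE mulmxA PAB -mulmxA IH mulmxA.
exists [seq B i i | i <- enum 'I_n.+1]; split.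
- by rewrite size_map size_enum_ord.
- by rewrite (char_poly_conj uP PAB) char_poly_trig// big_map big_enum.
- move=> l; rewrite big_map big_enum /=.
  have -> : A ^+ l = invmx P *m (B ^+ l *m P) by rewrite -PABl mulmxA mulVmx// mul1mx.
  rewrite mxtrace_mulC -mulmxA mulmxV// mulmx1.
  have [_ d] := trig_mxX l tB.
  by apply: eq_bigr => i _; rewrite d.
Qed.

(** Row i has entries c i, a i, b i in columns i - 1, i, i + 1; the functions are
    defined on all of nat so that deleting the first row and column is a shift of
    the arguments. *)
Definition tridiag (F : nzRingType) (a b c : nat -> F) n : 'M[F]_n :=
  \matrix_(i < n, j < n)
    if j == i.+1 :> nat then b i
    else if j == i :> nat then a i
    else if j.+1 == i :> nat then c i
    else 0.

(** The only nonzero terms of the expansion along the first row are those of the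
    columns 0 and 1; the second minor has a single nonzero entry in its first
    column. *)
Lemma det_tridiag (F : comNzRingType) (a b c : nat -> F) n :
  \det (tridiag a b c n.+2) =
    a 0%N * \det (tridiag (a \o S) (b \o S) (c \o S) n.+1)
    - b 0%N * c 1%N * \det (tridiag (a \o S \o S) (b \o S \o S) (c \o S \o S) n).
Proof.
rewrite (expand_det_row _ ord0) big_ord_recl big_ord_recl big1 ?addr0; last first.
  by move=> i _; rewrite mxE/= mul0r.
congr (_ + _).
  rewrite mxE/= /cofactor expr0 mul1r; congr (_ * \det _).
  by apply/matrixP => i j; rewrite !mxE.
rewrite mxE/= /cofactor expr1 mulN1r mulrN -mulrA; congr (- (_ * _)).
rewrite (expand_det_col _ ord0) big_ord_recl big1 ?addr0; last first.
  by move=> i _; rewrite !mxE/= mul0r.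
rewrite !mxE/= /cofactor expr0 mul1r; congr (_ * \det _).
by apply/matrixP => i j; rewrite !mxE.
Qed.

Section RealSpectrum.
Variable R : rcfType.
Local Notation C := (R[i]).
Local Notation toC := (real_complex R).

(** Write p_n for the determinant of the trailing block of size n. The
    recurrence gives
    Im (p_(n+2) p_(n+1)^* ) = Im z |p_(n+1)|^2 + b_0 c_1 Im (p_(n+1) p_n^* ),
    a sum of nonnegative terms. In particular p_n has no zero in the upper
    half-plane. The argument covers the case where exactly one of b_i and c_(i+1)
    vanishes, in which the matrix need not be similar to a symmetric one. *)
Lemma Im_det_tridiag_gt0 (z : C) (a b c : nat -> R) n : 0 < complex.Im z ->
  (forall i, 0 <= b i * c i.+1) ->
  let D a b c := tridiag (fun i => z - toC (a i)) (fun i => - toC (b i)) (fun i => - toC (c i)) in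
  0 < complex.Im (\det (D a b c n.+1) *
       (\det (D (a \o S) (b \o S) (c \o S) n))^*%C).
Proof.
move=> z0 bc; set D := (D in let D := D in _) => /=; elim: n a b c bc => [|n IH] a b c bc.
  rewrite det_mx11 mxE/= det_mx00.
  rewrite rmorph1 mulr1; case: z z0 {D} => x y /=; by rewrite oppr0 addr0.
rewrite det_tridiag mulrBl.
have := IH (a \o S) (b \o S) (c \o S) (fun i => bc i.+1).
rewrite -/(D (a \o S) (b \o S) (c \o S) n.+1).
rewrite -/(D (a \o S \o S) (b \o S \o S) (c \o S \o S) n).
set p := \det (D (a \o S) _ _ _); set q := \det _.
have := bc 0%N; set be := b 0%N * c 1%N => be0.
have -> : - toC (b 0%N) * - toC (c 1%N) = toC be by rewrite mulrNN -rmorphM.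
move: p q; case: z z0 {D IH} => x y /= y0 [p1 p2] [q1 q2] /= pq.
suff : 0 < y * (p1 ^+ 2 + p2 ^+ 2) + be * (p1 * - q2 + p2 * q1).
  by apply: etrans; congr (0 < _); ring.
have : 0 < p1 ^+ 2 + p2 ^+ 2.
  rewrite lt_neqAle addr_ge0 ?sqr_ge0// andbT eq_sym paddr_eq0 ?sqr_ge0//.
  rewrite !sqrf_eq0; apply/negP => /andP[/eqP p10 /eqP p20].
  by move: pq; rewrite p10 p20 !mul0r addr0 ltxx.
by move=> h; rewrite ltr_pwDl ?mulr_gt0// mulr_ge0// ltW.
Qed.

(** The characteristic polynomial has real coefficients, so a root in the lower
    half-plane would give one in the upper half-plane. *)
Lemma tridiag_eigenvalue_real (a b c : nat -> R) n (z : C) :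
  (forall i, 0 <= b i * c i.+1) ->
  root (char_poly (map_mx toC (tridiag a b c n.+1))) z -> complex.Im z = 0.
Proof.
move=> bc; have key (w : C) : root (char_poly (map_mx toC (tridiag a b c n.+1))) w ->
    ~ 0 < complex.Im w.
  rewrite -eigenvalue_root_char => /eigenvalueP[v vA v0] w0.
  have := @Im_det_tridiag_gt0 w a b c n w0 bc => /=.
  set D := tridiag _ _ _ _; suff -> : \det D = 0 by rewrite mul0r ltxx.
  apply/eqP/det0P; exists v => //.
  have -> : D = w%:M - map_mx toC (tridiag a b c n.+1).
    apply/matrixP => i j; rewrite !mxE -val_eqE /= [i == j :> nat]eq_sym.
    case: ifPn => [/eqP ->|_]; first by rewrite gtn_eqF// mulr0n add0r.
    case: ifPn => [_|_]; first by rewrite mulr1n.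
    by case: ifPn => _; rewrite mulr0n add0r// rmorph0 oppr0.
  by rewrite mulmxBr vA mul_mx_scalar subrr.
move=> rz; apply/eqP; case: (ltrgtP (complex.Im z) 0) => // [zn|zp]; last first.
  by have := key _ rz zp.
have rz' : root (char_poly (map_mx toC (tridiag a b c n.+1))) (z^*)%C.
  move: rz; rewrite -map_char_poly -complex_root_conj -map_poly_comp.
  suff -> : map_poly (conjc \o toC) (char_poly (tridiag a b c n.+1)) =
    map_poly toC (char_poly (tridiag a b c n.+1)) by [].
  by apply/eq_map_poly => x /=; rewrite oppr0.
by have := key _ rz'; case: {rz rz'} z zn => x y /= y0; rewrite oppr_gt0 => /(_ y0).
Qed.

End RealSpectrum.

(** A row eigenvector v satisfies |z| |v|_1 = |v A|_1 <= |v|_1, since the map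
    v |-> v A does not increase the l^1 norm. *)
Lemma substochastic_eigenvalue_le1 (F : numFieldType) n (A : 'M[F]_n) (z : F) :
  (forall i j, 0 <= A i j) -> (forall i, \sum_j A i j <= 1) ->
  eigenvalue A z -> `|z| <= 1.
Proof.
move=> A0 A1 /eigenvalueP[v vA v0].
have s0 : 0 < \sum_j `|v 0 j|.
  rewrite lt_neqAle sumr_ge0// andbT eq_sym.
  apply: contra v0; rewrite psumr_eq0// => /allP h.
  apply/eqP/rowP => j; rewrite mxE; apply/eqP; rewrite -normr_eq0.
  by apply: h; rewrite mem_index_enum.
rewrite -(ler_pM2r s0) mul1r mulr_sumr.
apply: (@le_trans _ _ (\sum_j \sum_i `|v 0 i| * A i j)).
  apply: ler_sum => j _; rewrite -normrM.
  have := congr1 (fun w : 'rV_n => w 0 j) vA; rewrite !mxE => <-.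
  rewrite (le_trans (ler_norm_sum _ _ _))//; apply: ler_sum => i _.
  by rewrite normrM (ger0_norm (A0 _ _)).
rewrite exchange_big/=; apply: ler_sum => i _.
by rewrite -mulr_sumr ler_piMr.
Qed.

(** Once the characteristic polynomial is known to split over R, the list of
    roots with multiplicities is the list of its linear factors. *)
Lemma eigenvalues_perm (R : realType) n (A : 'M[R]_n) (s : seq R) :
  char_poly A = \prod_(x <- s) ('X - x%:P) -> perm_eq (eigenvalues A) s.
Proof.
move=> As; apply/allP => x _ /=; apply/eqP.
have A0 : char_poly A != 0 by rewrite monic_neq0// char_poly_monic.
have -> : count_mem x s = mup x (char_poly A) by rewrite As mu_prod_XsubC.
rewrite /eigenvalues count_flatten -map_comp sumnE big_map.
have [xr|xr] := boolP (x \in rootsR (char_poly A)); last first.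
  rewrite big1_seq => [|y /andP[_ yr]]; last first.
    by rewrite /= count_nseq/=; case: eqP => [yx|]; [rewrite -yx yr in xr|rewrite mul0n].
  apply/esym/mupNroot; apply: contra xr => xr.
  by rewrite -(roots_on_rootsR A0) in_itv/=.
rewrite (bigD1_seq x)//= ?count_nseq/= ?eqxx ?mul1n; last exact: uniq_roots.
rewrite big1 ?addn0// => y yx; rewrite /= count_nseq/= (negbTE yx) mul0n//.
Qed.

Lemma tridiag_spectrum (R : realType) (a b c : nat -> R) n
    (K := tridiag a b c n.+1) :
  (forall i, 0 <= b i * c i.+1) ->
  (forall i j, 0 <= K i j) -> (forall i, \sum_j K i j <= 1) ->
  [/\ size (eigenvalues K) = n.+1,
      {in eigenvalues K, forall x, -1 <= x <= 1} &
      forall l, \sum_(x <- eigenvalues K) x ^+ l = \tr (K ^+ l)].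
Proof.
move=> bc K0 K1; pose f : {rmorphism R -> R[i]} := real_complex R.
have [z [sz zK zt]] := trace_powers (map_mx f K).
have zr x : x \in z -> x = f (complex.Re x).
  move=> xz; rewrite {1}[x]complexE (@tridiag_eigenvalue_real _ a b c n x)//.
    by rewrite rmorph0 mulr0 addr0.
  by rewrite -/K zK root_prod_XsubC.
set s := map (@complex.Re R) z.
have zs : z = map f s.
  by rewrite -map_comp -[LHS]map_id; apply/eq_in_map => x /zr.
have Ks : char_poly K = \prod_(x <- s) ('X - x%:P).
  apply: (map_poly_inj f); rewrite map_char_poly zK zs big_map rmorph_prod.
  by apply: eq_bigr => x _; rewrite rmorphB/= map_polyX map_polyC.
have pe := eigenvalues_perm Ks; split.
- by rewrite (perm_size pe) size_map.
- move=> x; rewrite (perm_mem pe) => xs; rewrite -ler_norml.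
  apply: substochastic_eigenvalue_le1 K0 K1 _.
  by rewrite eigenvalue_root_char Ks root_prod_XsubC.
- move=> l; rewrite (perm_big s pe)/=; apply: (fmorph_inj f).
  rewrite /s big_map rmorph_sum -trace_map_mx (rmorphXn (map_mx f)) zt.
  rewrite [in RHS]zs !big_map.
  by apply: eq_bigr => x _; rewrite rmorphXn.
Qed.

(** * Powers of the birth-and-death kernel and the random walk *)

Definition substochastic (F : numDomainType) n (A : 'M[F]_n) :=
  (forall i j, 0 <= A i j) /\ (forall i, \sum_j A i j <= 1).

Lemma substochasticX (F : numDomainType) n (A : 'M[F]_n) l :
  substochastic A -> substochastic (A ^+ l).
Proof.
move=> [A0 A1]; elim: l => [|l [IH0 IH1]].
  rewrite expr0; split=> [i j|i]; first by rewrite mxE ler0n.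
  rewrite (bigD1 i)//= mxE eqxx big1 ?addr0// => j ji.
  by rewrite mxE eq_sym (negbTE ji).
split=> [i j|i]; rewrite exprS.
  by rewrite mxE sumr_ge0// => k _; rewrite mulr_ge0.
under eq_bigr do rewrite mxE.
rewrite exchange_big/= (le_trans _ (A1 i))//; apply: ler_sum => k _.
by rewrite -mulr_sumr ler_piMr.
Qed.

Lemma substochastic_diag (F : numDomainType) n (A : 'M[F]_n) i :
  substochastic A -> 0 <= A i i <= 1.
Proof.
move=> [A0 A1]; rewrite A0 (le_trans _ (A1 i))// (bigD1 i)//= lerDl.
by rewrite sumr_ge0.
Qed.

Lemma tridiag_substochastic (F : numDomainType) (a b c : nat -> F) n :
  (forall i, [/\ 0 <= a i, 0 <= b i, 0 <= c i & a i + b i + c i <= 1]) ->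
  substochastic (tridiag a b c n).
Proof.
move=> abc; split=> [i j|i]; have [a0 b0 c0 s1] := abc i.
  by rewrite mxE; do 3?case: ifP.
rewrite (le_trans _ s1)//.
have h (x : F) (m : nat) : 0 <= x -> \sum_(j < n) (if j == m :> nat then x else 0) <= x.
  by move=> x0; rewrite -big_mkcond/= (big_ord1_eq _ (fun=> x)); case: ifP.
have h' (x : F) (m : nat) : 0 <= x -> \sum_(j < n) (if j.+1 == m :> nat then x else 0) <= x.
  move=> x0; case: m => [|m]; first by rewrite big1.
  by apply: h.
apply: (le_trans _ (lerD (lerD (h _ i a0) (h _ i.+1 b0)) (h' _ i c0))).
rewrite -!big_split/=; apply: ler_sum => j _; rewrite mxE.
case: eqP => [->|_]; first by rewrite gtn_eqF// gtn_eqF// add0r addr0.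
case: eqP => [->|_]; last by rewrite !add0r.
by rewrite addr0 gtn_eqF ?addr0.
Qed.

Section Walk.
Variable R : realType.
Implicit Types (e : env R) (n l : nat).

Lemma Lambda3_ge0 (v : 3.-tuple R) k : Lambda3 v -> 0 <= v`_k.
Proof.
move=> [v01 _]; have [k3|k3] := ltnP k 3; last by rewrite nth_default ?size_tuple.
by have /andP[] := v01 (Ordinal k3); rewrite (tnth_nth 0).
Qed.

Lemma Lambda3_sum (v : 3.-tuple R) : Lambda3 v -> v`_1 + v`_2 + v`_0 = 1.
Proof. by move=> [_ <-]; rewrite addrC addrA. Qed.

Lemma site_probsP e n i : (forall i, Lambda3 (e i)) ->
  let v := site_probs e n i in
  [/\ 0 <= v`_1, 0 <= v`_2, 0 <= v`_0 & v`_1 + v`_2 + v`_0 <= 1].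
Proof.
move=> he v; rewrite /v /site_probs; do 2?case: ifP => _.
- have h := he 1; rewrite /vplus/= !Lambda3_ge0// addr_ge0 ?Lambda3_ge0// addr0.
  by rewrite [X in _ + X]addrC addrA Lambda3_sum.
- have h := he n; rewrite /vminus/= !Lambda3_ge0// addr_ge0 ?Lambda3_ge0// addr0.
  by rewrite [X in _ + X]addrC addrA Lambda3_sum.
- by rewrite !Lambda3_ge0// Lambda3_sum.
Qed.

Lemma bd_kernelE e n : bd_kernel e n =
  tridiag (fun i => (site_probs e n i.+1)`_1) (fun i => (site_probs e n i.+1)`_2)
    (fun i => (site_probs e n i.+1)`_0) n.
Proof. by apply/matrixP => i j; rewrite !mxE. Qed.

Lemma bd_kernel_substochastic e n : (forall i, Lambda3 (e i)) ->
  substochastic (bd_kernel e n).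
Proof.
by move=> he; rewrite bd_kernelE; apply: tridiag_substochastic => i; exact: site_probsP.
Qed.

Lemma bd_kernel_spectrum e n : (forall i, Lambda3 (e i)) ->
  let K := bd_kernel e n.+1 in
  [/\ size (eigenvalues K) = n.+1,
      {in eigenvalues K, forall x, -1 <= x <= 1} &
      forall l, \sum_(x <- eigenvalues K) x ^+ l = \tr (K ^+ l)].
Proof.
move=> he /=; have [] := bd_kernel_substochastic n.+1 he; rewrite bd_kernelE => K0 K1.
apply: tridiag_spectrum => // i.
have [_ b0 _ _] := @site_probsP e n.+1 i.+1 he.
have [_ _ c0 _] := @site_probsP e n.+1 i.+2 he.
exact: mulr_ge0.
Qed.

Lemma iter_shift_env e m : iter m (@shift_env R) e = fun k => e (k + m%:Z).
Proof.
elim: m => [|m IH] /=; apply/funext => k; first by rewrite addr0.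
by rewrite IH /shift_env; congr (e _); lia.
Qed.

Lemma walk_law_supp e l (j : int) : (l < `|j|)%N -> walk_law e l j = 0.
Proof.
elim: l j => [|l IH] j lj /=; first by case: eqP => // j0; move: lj; rewrite j0.
by rewrite !big_cons big_nil !IH ?mul0r ?addr0//; lia.
Qed.

(** Induction on the number of steps: a path counted on the left has not left the
    ball of radius l around i, so the last step starts at an interior site, where
    the kernel and the walk have the same transition probabilities. *)
Lemma bd_kernel_walk e n l (i j : 'I_n) : (l <= i)%N -> (i + l < n)%N ->
  (bd_kernel e n ^+ l) i j =
  walk_law (iter i.+1 (@shift_env R) e) l (j%:Z - i%:Z).
Proof.
rewrite iter_shift_env; set e' := fun k => _.
elim: l j => [|l IH] j li lin.
  rewrite expr0 mxE /=; congr (_%:R); rewrite -val_eqE/=; lia.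
pose G (k : nat) : R :=
  walk_law e' l (k%:Z - i%:Z) * walk_step e' (k%:Z - i%:Z) (j%:Z - i%:Z).
have KG (k : 'I_n) : (bd_kernel e n ^+ l) i k * bd_kernel e n k j = G k.
  rewrite IH; [|lia|lia]; rewrite /G.
  have [lk|kl] := ltnP l `|k%:Z - i%:Z|%N; first by rewrite walk_law_supp// !mul0r.
  congr (_ * _); rewrite mxE /site_probs /walk_step.
  rewrite (_ : (k.+1 == 1%N) = false); last lia.
  rewrite (_ : (k.+1 == n) = false); last lia.
  have -> : e' (k%:Z - i%:Z) = e k.+1 by rewrite /e'; congr (e _); lia.
  have -> : (j%:Z - i%:Z == k%:Z - i%:Z - 1) = (j.+1 == k) by lia.
  have -> : (j%:Z - i%:Z == k%:Z - i%:Z) = (j == k :> nat) by lia.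
  have -> : (j%:Z - i%:Z == k%:Z - i%:Z + 1) = (j == k.+1 :> nat) by lia.
  by do 6?[case: eqP => ? //]; lia.
rewrite exprSr mxE; under eq_bigr do rewrite KG.
have G0 (k : nat) : [|| k.+1 == j, k == j | k == j.+1] = false -> G k = 0.
  move=> h; rewrite /G /walk_step !ifF ?mulr0//; lia.
(* Only j - 1, j and j + 1 contribute; those outside the segment are too far
   from i to have been reached, so adding them changes nothing. *)
have GE (k : nat) : G k = (if k.+1 == j then G k else 0) +
    (if k == j :> nat then G k else 0) + (if k == j.+1 then G k else 0).
  have := G0 k; case: (ltngtP k j) => [kj|kj|->] /=.
  - rewrite (_ : k == j.+1 = false); last lia.
    by case: eqP => _; rewrite !addr0// => ->.
  - rewrite (_ : k.+1 == j = false); last lia.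
    by case: eqP => _; rewrite !add0r// => ->.
  - rewrite (_ : j.+1 == j = false); last lia.
    by rewrite (_ : (j : nat) == j.+1 = false); [rewrite add0r addr0|lia].
under eq_bigr do rewrite GE.
rewrite !big_split/= -!big_mkcond/= !big_ord1_eq ltn_ord/=.
rewrite !big_cons big_nil addr0 addrA; congr (_ + _ + _).
- case: (posnP j) => [j0|j0].
    by rewrite big1 ?walk_law_supp ?mul0r//; [lia|move=> k; lia].
  rewrite (eq_bigl (fun k : 'I_n => k == j.-1 :> nat)); last by move=> k /=; lia.
  rewrite big_ord1_eq (leq_ltn_trans (leq_pred j) (ltn_ord j)).
  by rewrite /G; congr (walk_law _ _ _ * walk_step _ _ _); lia.
- case: ifPn => jn.
    by rewrite /G; congr (walk_law _ _ _ * walk_step _ _ _); lia.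
  by rewrite walk_law_supp ?mul0r//; lia.
Qed.

(** The return probability is a diagonal entry of a power of a substochastic
    matrix: the kernel of size 2l + 1 centred at the origin. *)
Lemma return_prob_itv e l : (forall i, Lambda3 (e i)) -> 0 <= return_prob e l <= 1.
Proof.
move=> he; pose e' : env R := fun k => e (k - l.+1%:Z).
have -> : return_prob e l = (bd_kernel e' (2 * l).+1 ^+ l) (inord l) (inord l).
  have il : @inord (2 * l) l = l :> nat by rewrite inordK//; lia.
  rewrite bd_kernel_walk ?il//; last lia.
  rewrite subrr iter_shift_env /return_prob; congr (walk_law _ _ _).
  by apply/funext => k; rewrite /e'; congr (e _); lia.
by apply/substochastic_diag/substochasticX/bd_kernel_substochastic => i; exact: he.
Qed.

(** At the l sites nearest to each end the two terms differ by at most 1, since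
    both lie in [0, 1]; at all other sites they agree. *)
Lemma trace_return_prob e l n : (forall i, Lambda3 (e i)) ->
  `| \tr (bd_kernel e n ^+ l) -
     \sum_(i < n) return_prob (iter i.+1 (@shift_env R) e) l | <= (2 * l)%:R.
Proof.
move=> he; rewrite /mxtrace -sumrB.
have d (i : 'I_n) : `|(bd_kernel e n ^+ l) i i - return_prob (iter i.+1 (@shift_env R) e) l|
    <= ((i < l)%N + (n <= i + l)%N)%:R.
  have [/andP[li il]|h] := boolP ((l <= i) && (i + l < n))%N.
    by rewrite bd_kernel_walk// subrr /return_prob subrr normr0.
  apply: (@le_trans _ _ 1); last by rewrite ler1n; lia.
  have /andP[? ?] := substochastic_diag i (substochasticX l (bd_kernel_substochastic n he)).
  have /andP[? ?] : 0 <= return_prob (iter i.+1 (@shift_env R) e) l <= 1.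
    by apply: return_prob_itv => k; rewrite iter_shift_env.
  by rewrite ler_norml; apply/andP; split; lra.
apply: (le_trans (ler_norm_sum _ _ _)); apply: (le_trans (ler_sum _ (fun i _ => d i))).
rewrite -natr_sum ler_nat big_split/= mul2n -addnn.
have c m : (\sum_(i < m) (i < l) <= l)%N.
  suff -> : (\sum_(i < m) (i < l) = minn m l)%N by rewrite geq_minr.
  elim: m => [|m IH]; first by rewrite big_ord0 min0n.
  by rewrite big_ord_recr/= IH; lia.
apply: leq_add; first exact: c.
rewrite (reindex_inj rev_ord_inj)/= (leq_trans _ (c n))//.
by apply: leq_sum => i _ /=; have := ltn_ord i; case: leqP; case: ltnP => //=; lia.
Qed.
End Walk.

(** * The pointwise ergodic theorem *)

Section Ergodic.
Context (d : measure_display) (X : measurableType d) (R : realType).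
Variables (P : probability X R) (tau : X -> X).
Hypothesis mtau : measurable_fun setT tau.
Hypothesis Ptau : forall A, measurable A -> P (tau @^-1` A) = P A.

Local Notation integrable g := (P.-integrable setT (EFin \o g)).

Lemma ge0_integral_comp_tau (h : X -> \bar R) : measurable_fun setT h ->
  (forall x, 0 <= h x)%E -> (\int[P]_x h (tau x) = \int[P]_x h x)%E.
Proof.
move=> mh h0; rewrite -[LHS](@ge0_integral_pushforward _ _ X X R tau mtau P setT h)//.
by apply: eq_measure_integral => A mA _; exact: Ptau.
Qed.

Lemma integrable_comp_tau (h : X -> R) : integrable h -> integrable (h \o tau).
Proof.
move=> /integrableP[mh hoo]; apply/integrableP; split.
  exact: (measurableT_comp mh mtau).
rewrite (@ge0_integral_comp_tau (fun x => `|(h x)%:E|%E))//.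
exact: (measurableT_comp _ mh).
Qed.

Lemma Rintegral_comp_tau (h : X -> R) : integrable h ->
  \int[P]_x h (tau x) = \int[P]_x h x.
Proof.
move=> ih; rewrite /Rintegral; congr fine.
have mh : measurable_fun setT (EFin \o h) by case/integrableP : ih.
have := @integral_pushforward _ _ X X R tau mtau P setT (EFin \o h) mh.
move=> /(_ (integrable_comp_tau ih) measurableT) /= <-.
by apply: eq_measure_integral => A mA _; exact: Ptau.
Qed.

Definition birkhoff_sum (g : X -> R) n x := \sum_(i < n) g (iter i tau x).

(** The maximum of the Birkhoff sums of length 0 to n. The recursion
    M_(n+1) = max (g + M_n o tau) 0 is the form used in the maximal inequality. *)
Fixpoint birkhoff_max (g : X -> R) n x :=
  if n is m.+1 then Num.max (g x + birkhoff_max g m (tau x)) 0 else 0.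

Lemma birkhoff_sumS g n x :
  birkhoff_sum g n.+1 x = g x + birkhoff_sum g n (tau x).
Proof.
rewrite /birkhoff_sum big_ord_recl; congr (_ + _).
by apply: eq_bigr => i _; rewrite /= -iterSr.
Qed.

Lemma birkhoff_max_ge0 g n x : 0 <= birkhoff_max g n x.
Proof. by case: n => //= n; rewrite le_max lexx orbT. Qed.

Lemma birkhoff_max_nd g n x : birkhoff_max g n x <= birkhoff_max g n.+1 x.
Proof.
elim: n x => [|n IH] x; first exact: birkhoff_max_ge0.
rewrite [leLHS]/= [leRHS]/= ge_max !le_max lexx orbT andbT.
by rewrite lerD2l IH.
Qed.

Lemma birkhoff_sum_le_max g n x : birkhoff_sum g n x <= birkhoff_max g n x.
Proof.
elim: n x => [|n IH] x; first by rewrite /birkhoff_sum big_ord0.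
by rewrite birkhoff_sumS /= le_max lerD2l IH.
Qed.

Lemma integrable_birkhoff_max g n : integrable g -> integrable (birkhoff_max g n).
Proof.
move=> ig; elim: n => [|n IH]; first exact: integrable0.
have : integrable (g \+ (birkhoff_max g n \o tau)).
  by have := integrableD measurableT ig (integrable_comp_tau IH).
by move=> /(integrable_funrpos measurableT).
Qed.

(** Where M_(n+1) > 0 the recursion gives
    g = M_(n+1) - M_n o tau >= M_(n+1) - M_(n+1) o tau, and elsewhere the right-hand
    side is at most 0; its integral vanishes because tau preserves the measure. *)
Lemma maximal_ergodic g n : integrable g ->
  0 <= \int[P]_x (g x * \1_[set x | 0 < birkhoff_max g n.+1 x] x).
Proof.
move=> ig; have iM := integrable_birkhoff_max n.+1 ig.
set M := birkhoff_max g n.+1 in iM *; set A := [set x | _].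
have mA : measurable A.
  have mM : measurable_fun setT M by case/integrableP : iM => /measurable_EFinP.
  rewrite -[A]setTI (_ : A = M @^-1` `]0, +oo[%classic).
    exact: mM.
  by apply/seteqP; split=> x /=; rewrite in_itv/= andbT.
have iMt := integrable_comp_tau iM.
have -> : 0 = \int[P]_x (M x - M (tau x)).
  by rewrite RintegralB// Rintegral_comp_tau// subrr.
apply: le_Rintegral => //.
- have := integrableB measurableT iM iMt.
  by congr (P.-integrable _ _).
- have [h _] := @integrable_mkcond _ X R P A (EFin \o g) mA.
  have := h (integrableS measurableT mA (@subsetT _ _) ig).
  congr (P.-integrable _ _); apply/funext => x; rewrite /patch /= indicE.
  by case: (x \in A); rewrite /= ?mulr1 ?mulr0.
- move=> x _; rewrite indicE; case: (boolP (x \in A)) => [|/negP].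
    rewrite inE /A/= mulr1 => Mx; rewrite lerBlDr.
    move: Mx; rewrite /M [birkhoff_max _ _ _]/= lt_max ltxx orbF => gM.
    by rewrite (max_idPl (ltW gM)) lerD2l birkhoff_max_nd.
  rewrite inE /A/= mulr0 => /negP; rewrite -leNgt => Mx.
  by have := birkhoff_max_ge0 g n.+1 (tau x); rewrite -/M; lra.
Qed.

Hypothesis Perg : forall A, measurable A -> tau @^-1` A = A ->
  P A = 0%E \/ P A = 1%E.

(** This set is exactly invariant under tau, not only up to null sets, because
    the sums at x and at tau x differ by the fixed amount g x; so ergodicity for
    strictly invariant sets is enough. *)
Definition unbounded_sums g := [set x | forall k : nat, exists n, k%:R < birkhoff_sum g n x].

Lemma measurable_iter i : measurable_fun setT (iter i tau).
Proof.
elim: i => [|i IH]; first exact: measurable_id.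
exact: (measurableT_comp mtau IH).
Qed.

Lemma measurable_birkhoff_sum g n : measurable_fun setT g ->
  measurable_fun setT (birkhoff_sum g n).
Proof.
move=> mg; apply: measurable_sum => i.
exact: (measurableT_comp mg (measurable_iter i)).
Qed.

Lemma measurable_unbounded_sums g : measurable_fun setT g ->
  measurable (unbounded_sums g).
Proof.
move=> mg; rewrite (_ : unbounded_sums g = \bigcap_k \bigcup_n
   (birkhoff_sum g n @^-1` `]k%:R, +oo[%classic)).
  apply: bigcap_measurable => // k _; apply: bigcup_measurable => n _.
  by rewrite -[X in measurable X]setTI; exact: measurable_birkhoff_sum.
apply/seteqP; split=> x /= h k.
  by have [n nk] := h k; exists n => //=; rewrite in_itv/= nk.
by have [n _] := h k I; rewrite /= in_itv/= andbT => ?; exists n.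
Qed.

Lemma unbounded_sums_inv g : tau @^-1` (unbounded_sums g) = unbounded_sums g.
Proof.
apply/seteqP; split=> x /= h k.
  have [n] := h (k + (Num.truncn `|g x|).+1)%N; rewrite natrD => kn; exists n.+1.
  rewrite birkhoff_sumS; move: kn.
  have := truncnS_gt `|g x|; have := ler_norm (- g x); rewrite normrN; lra.
have [[|n]] := h (k + (Num.truncn `|g x|).+1)%N.
  by rewrite /birkhoff_sum big_ord0 ltNge ler0n.
rewrite birkhoff_sumS natrD => kn; exists n; move: kn.
have := truncnS_gt `|g x|; have := ler_norm (g x); lra.
Qed.

(** Otherwise the set has full measure, so the events M_(n+1) > 0 increase to an
    almost sure event, and the maximal inequality passes to the limit to give a
    nonnegative integral of g. *)
Lemma unbounded_sums_negligible g : integrable g -> \int[P]_x g x < 0 ->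
  P.-negligible (unbounded_sums g).
Proof.
move=> ig g0; have mg : measurable_fun setT g by case/integrableP: ig => /measurable_EFinP.
have mB := measurable_unbounded_sums mg.
apply/(negligibleP _ mB).
have [//|PB1] := Perg mB (unbounded_sums_inv g).
exfalso; suff : 0 <= \int[P]_x g x by rewrite leNgt g0.
have aeB : {ae P, forall x, unbounded_sums g x}.
  exists (~` unbounded_sums g); split => //; first exact: measurableC.
  by rewrite probability_setC// PB1 subee.
pose A n := [set x | 0 < birkhoff_max g n.+1 x].
have mA n : measurable (A n).
  have mM : measurable_fun setT (birkhoff_max g n.+1).
    by have /integrableP[/measurable_EFinP] := integrable_birkhoff_max n.+1 ig.
  rewrite -[A n]setTI (_ : A n = birkhoff_max g n.+1 @^-1` `]0, +oo[%classic).
    exact: mM.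
  by apply/seteqP; split=> x /=; rewrite in_itv/= andbT.
have mgA n : measurable_fun setT (fun x => (g x * \1_(A n) x)%:E).
  apply/measurable_EFinP; apply: measurable_funM => //.
have cv : {ae P, forall x, setT x -> (g x * \1_(A n) x)%:E @[n --> \oo] --> (EFin \o g) x}.
  apply: filterS aeB => x Bx _.
  have [n n0] := Bx 0%N.
  have h m : (n <= m)%N -> A m x.
    move=> nm; rewrite /A/=; apply: (lt_le_trans n0).
    apply: (le_trans (birkhoff_sum_le_max _ _ _)).
    have /nondecreasing_seqP nd := birkhoff_max_nd g ^~ x.
    exact: (nd n m.+1 (leqW nm)).
  apply: cvg_near_cst; exists n => // m /= nm.
  by rewrite indicE mem_set ?mulr1//; exact: h.
have dom : {ae P, forall x (n : nat), setT x -> (`|(g x * \1_(A n) x)%:E| <= `|(g x)%:E|)%E}.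
  apply: aeW => x n _; rewrite lee_fin normrM indicE; case: (x \in A n) => /=.
    by rewrite normr1 mulr1.
  by rewrite normr0 mulr0.
have [ig' _ cvi] := @dominated_convergence _ X R P setT measurableT _ _ _ mgA
  (measurable_int P ig) cv (integrable_abse ig) dom.
rewrite -lee_fin /Rintegral fineK; last exact: integrable_fin_num.
have <- := cvg_lim (@ereal_hausdorff _) cvi.
apply: lime_ge; first by apply/cvg_ex; eexists; exact: cvi.
apply: nearW => n; have iA : P.-integrable setT (fun x => (g x * \1_(A n) x)%:E).
  apply: le_integrable (integrable_abse ig) => // x _.
  by rewrite abse_id lee_fin normrM indicE; case: (x \in A n);
    rewrite ?normr1 ?normr0 ?mulr1 ?mulr0.
by rewrite -[leRHS](fineK (integrable_fin_num measurableT iA)) lee_fin; exact: maximal_ergodic.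
Qed.

Lemma birkhoff_sum_bounded g : integrable g -> \int[P]_x g x < 0 ->
  {ae P, forall x, exists K, forall n, birkhoff_sum g n x <= K}.
Proof.
move=> ig g0; apply: negligibleS (unbounded_sums_negligible ig g0) => x /= h k.
apply: contrapT => h'; apply: h; exists k%:R => n; rewrite leNgt.
by apply/negP => kn; apply: h'; exists n.
Qed.

Lemma birkhoff_sum_affine f (a b : R) n x :
  birkhoff_sum (fun x => a * f x + b) n x = a * birkhoff_sum f n x + n%:R * b.
Proof.
by rewrite /birkhoff_sum big_split/= -mulr_sumr sumr_const card_ord mulr_natl.
Qed.

(** Apply the boundedness of the sums to f - c - 1/(m+1) and c - f - 1/(m+1),
    both of negative integral, where c is the integral of f. *)
Theorem birkhoff f : integrable f ->
  {ae P, forall x, n.+1%:R^-1 * birkhoff_sum f n.+1 x @[n --> \oo] --> \int[P]_x f x}.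
Proof.
move=> If; set c := \int[P]_x f x.
have aff (a b : R) : integrable (fun x => a * f x + b) /\
    \int[P]_x (a * f x + b) = a * c + b.
  have Ia : integrable (fun x => a * f x) by apply: (integrableZl measurableT a If).
  have Ib : integrable (cst b) by apply: finite_measure_integrable_cst.
  split; first exact: (integrableD measurableT Ia Ib).
  rewrite RintegralD// RintegralZl// Rintegral_cst//.
  by rewrite [X in fine X](@probability_setT _ _ _ P) mulr1.
clearbody c.
have h (m : nat) : {ae P, forall x, exists K, forall n,
    `|birkhoff_sum f n x - n%:R * c| <= K + n%:R * m.+1%:R^-1}.
  have : 0 < (m.+1%:R^-1 : R) by rewrite invr_gt0.
  move: (m.+1%:R^-1 : R) => v m0.
  have [I1 e1] := aff 1 (- c - v).
  have [I2 e2] := aff (-1) (c - v).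
  have := birkhoff_sum_bounded I1; rewrite e1 mul1r addrA subrr add0r oppr_lt0 => /(_ m0) h1.
  have := birkhoff_sum_bounded I2; rewrite e2 mulN1r addrA addNr add0r oppr_lt0 => /(_ m0) h2.
  apply: filterS2 h1 h2 => x [K1 h1] [K2 h2]; exists (`|K1| + `|K2|) => n.
  have := h1 n; have := h2 n; rewrite !birkhoff_sum_affine !mulrDr.
  have := ler_norm K1; have := ler_norm K2.
  have := normr_ge0 K1; have := normr_ge0 K2.
  rewrite ler_norml => *; apply/andP; split; lra.
have := ae_foralln h; apply: filterS => x {}h.
apply/cvgrPdist_le => e e0.
have [m me] : exists m : nat, m.+1%:R^-1 <= e / 2.
  exists (Num.truncn (e / 2)^-1).
  rewrite invf_ple ?posrE ?divr_gt0//; exact/ltW/truncnS_gt.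
have [K hK] := h m.
exists (Num.truncn (K * (e / 2)^-1)) => // n /= Kn.
have n0 : 0 < (n.+1%:R : R) by [].
rewrite distrC -(ler_pM2l n0) -[X in X * _ <= _]ger0_norm// -normrM mulrBr mulrA divff// mul1r.
apply: (le_trans (hK n.+1)).
have : K <= n.+1%:R * (e / 2).
  rewrite -ler_pdivrMr ?divr_gt0// (le_trans (ltW (truncnS_gt _)))// ler_nat ltnS.
  exact: Kn.
move=> Ke; rewrite (splitr e) mulrDr; apply: lerD => //.
by rewrite ler_pM2l.
Qed.

End Ergodic.

(** * Polynomial approximation of ramps *)

Section PolyApprox.
Variable R : realType.
Implicit Types (f g : R -> R) (p : {poly R}).

(** The classical iteration p |-> p + (x^2 - p^2) / 2, which increases to |x| on
    [-1, 1]. *)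
Fixpoint abs_poly k : {poly R} :=
  if k is m.+1 then abs_poly m + 2^-1 *: ('X^2 - abs_poly m ^+ 2) else 0.

(** The error e satisfies e_(k+1) = e_k (1 - (|y| + p_k) / 2) <= e_k (1 - e_k / 2),
    and the bound 2 / (k + 2) is stable under this recursion. *)
Lemma abs_polyP k (y : R) : `|y| <= 1 ->
  0 <= (abs_poly k).[y] <= `|y| /\ `|y| - (abs_poly k).[y] <= 2 / k.+2%:R.
Proof.
move=> y1; elim: k => [|k [/andP[]]] /=.
  by rewrite horner0 lexx normr_ge0 subr0 divff.
rewrite !hornerE -[y ^+ 2]real_normK ?num_real//.
set p := (abs_poly k).[y]; set z := `|y| in y1 *; move=> p0 pz zp.
have -> : 2 / k.+3%:R = 2 * (k.+3%:R)^-1 :> R by [].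
have k2 : (k.+2%:R : R) = k%:R + 2 by rewrite -[k.+2]addn2 natrD.
have k3 : (k.+3%:R : R) = k%:R + 3 by rewrite -[k.+3]addn3 natrD.
rewrite k2 in zp; rewrite k3.
have k0 : 0 <= (k%:R : R) by [].
move: (k%:R : R) k0 zp {k2 k3} => N N0 zp.
split; first by apply/andP; split; nra.
have h : z - p <= 1 by lra.
move: zp; rewrite ler_pdivlMr ?ler_pdivlMr; try lra.
move=> zp.
have : (z - (p + 2^-1 * (z ^+ 2 - p ^+ 2))) <= (z - p) * (1 - (z - p) / 2) by nra.
move=> le1; have le2 : (z - p) * (1 - (z - p) / 2) * (N + 3) <= 2.
  set e := z - p in zp h *; have e0 : 0 <= e by rewrite /e; lra.
  have : e * (2 - e) * (N + 2) <= 2 * (2 - e) by nra.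
  nra.
by rewrite (le_trans _ le2)// ler_wpM2r//; lra.
Qed.

Definition poly_approx f := forall e : R, 0 < e ->
  exists p, forall x, -1 <= x <= 1 -> `|f x - p.[x]| <= e.

(** Dividing by B = 1 + |c| sends x - c into [-1, 1], where the iteration applies;
    k makes B * 2 / (k + 2) at most e. *)
Lemma poly_approx_abs c : poly_approx (fun x => `|x - c|).
Proof.
move=> e e0; pose B := 1 + `|c|.
have B0 : 0 < B by rewrite ltr_pwDl.
pose k := Num.truncn (2 * B / e).
exists (B *: (abs_poly k \Po (B^-1 *: ('X - c%:P)))) => x /andP[x1 x2].
rewrite !hornerE horner_comp !hornerE.
set y := B^-1 * (x - c).
have -> : x - c = B * y by rewrite /y mulrA divff ?gt_eqF// mul1r.
rewrite normrM (gtr0_norm B0) -mulrBr normrM (gtr0_norm B0).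
have y1 : `|y| <= 1.
  rewrite /y normrM gtr0_norm ?invr_gt0// mulrC ler_pdivrMr// mul1r.
  by rewrite (le_trans (ler_normB _ _))// /B lerD2r ler_norml x1.
have [/andP[p0 py] h] := abs_polyP k y1.
rewrite ger0_norm ?subr_ge0// mulrC -ler_pdivlMr// (le_trans h)//.
rewrite ler_pdivrMr// mulrAC ler_pdivlMr// [e * _]mulrC -ler_pdivrMr//.
rewrite (le_trans (ltW (truncnS_gt _)))// ler_nat -/k; lia.
Qed.

Lemma poly_approx_lin f g (a b c : R) : poly_approx f -> poly_approx g ->
  poly_approx (fun x => a * f x + b * g x + c).
Proof.
move=> hf hg e e0.
have [|p hp] := hf (e / (2 * (`|a| + 1))); first by rewrite divr_gt0// mulr_gt0// ltr_wpDl.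
have [|q hq] := hg (e / (2 * (`|b| + 1))); first by rewrite divr_gt0// mulr_gt0// ltr_wpDl.
exists (a *: p + b *: q + c%:P) => x x1; rewrite !hornerE.
have -> : a * f x + b * g x + c - (a * p.[x] + b * q.[x] + c) =
  a * (f x - p.[x]) + b * (g x - q.[x]) by ring.
have aux (u v : R) : `|v| <= e / (2 * (`|u| + 1)) -> `|u * v| <= e / 2.
  move=> h; rewrite normrM; move: h; rewrite ler_pdivlMr; last by rewrite mulr_gt0// ltr_wpDl.
  by have := normr_ge0 u; have := normr_ge0 v; nra.
rewrite (le_trans (ler_normD _ _))// [leRHS]splitr lerD//; apply: aux; [exact: hp|exact: hq].
Qed.

(** When a < b, this is 1 left of a, 0 right of b, and affine in between; written
    with absolute values because these are what polynomials approximate. *)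
Definition ramp a b x : R := 2^-1 + (`|x - b| - `|x - a|) / (2 * (b - a)).

Lemma poly_approx_ramp a b : poly_approx (ramp a b).
Proof.
rewrite (_ : ramp a b = fun x =>
    (2 * (b - a))^-1 * `|x - b| + - (2 * (b - a))^-1 * `|x - a| + 2^-1).
  exact: poly_approx_lin (poly_approx_abs b) (poly_approx_abs a).
by apply/funext => x; rewrite /ramp; ring.
Qed.

Lemma ramp_le a b x : a < b -> x <= a -> ramp a b x = 1.
Proof.
move=> ab xa; rewrite /ramp ler0_norm; last lra; rewrite ler0_norm; last lra.
by field; lra.
Qed.

Lemma ramp_ge a b x : a < b -> b <= x -> ramp a b x = 0.
Proof.
move=> ab xb; rewrite /ramp ger0_norm; last lra; rewrite ger0_norm; last lra.
by field; lra.
Qed.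

Lemma ramp_itv a b x : a < b -> 0 <= ramp a b x <= 1.
Proof.
move=> ab; have ba : 0 < b - a by lra.
have h : `| `|x - b| - `|x - a| | <= b - a.
  rewrite (le_trans (ler_dist_dist _ _))//.
  by rewrite (_ : x - b - (x - a) = - (b - a)) ?normrN ?gtr0_norm//; ring.
have h2 : `|(`|x - b| - `|x - a|) / (2 * (b - a))| <= 2^-1.
  rewrite normrM [`|_^-1|]gtr0_norm; last by rewrite invr_gt0; lra.
  by rewrite ler_pdivrMr; lra.
by move: h2; rewrite /ramp ler_norml => /andP[h1 h2]; apply/andP; split; lra.
Qed.

End PolyApprox.

(** * From moments to quantiles *)

Section Mean.
Variable R : realType.
Implicit Types (f g : R -> R) (p : {poly R}) (l : seq R) (s : nat -> seq R).

Definition mean f l : R := (size l)%:R^-1 * \sum_(x <- l) f x.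

Definition samples s :=
  forall n, size (s n) = n.+1 /\ {in s n, forall x, -1 <= x <= 1}.

Definition has_moments (m : nat -> R) s :=
  forall i, mean (fun x => x ^+ i) (s n) @[n --> \oo] --> m i.

Lemma mean_approx f g l e : (0 < size l)%N ->
  {in l, forall x, `|f x - g x| <= e} -> `|mean f l - mean g l| <= e.
Proof.
move=> l0 h; have l0' : 0 < (size l)%:R :> R by rewrite ltr0n.
rewrite /mean -mulrBr -sumrB normrM gtr0_norm ?invr_gt0//.
rewrite mulrC ler_pdivrMr// (le_trans (ler_norm_sum _ _ _))//.
rewrite (le_trans (_ : _ <= \sum_(x <- l) e))//.
  by rewrite big_seq [leRHS]big_seq; apply: ler_sum => x xl; exact: h.
by rewrite big_const_seq count_predT iter_addr addr0 mulr_natr.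
Qed.

Lemma mean_poly_cvg m s p : has_moments m s ->
  mean (horner p) (s n) @[n --> \oo] --> \sum_(i < size p) p`_i * m i.
Proof.
move=> hs; rewrite (_ : (fun n => _) =
    fun n => \sum_(i < size p) p`_i * mean (fun x => x ^+ i) (s n)).
  apply: cvg_big => [|i _]; first exact: add_continuous.
  by apply: cvgMl_tmp; exact: hs.
apply/funext => n; rewrite /mean.
rewrite (eq_bigr _ (fun x _ => horner_coef p x)).
rewrite exchange_big/= mulr_sumr; apply: eq_bigr => i _.
by rewrite -mulr_sumr mulrCA.
Qed.

(** The number c depends on f, m and e but not on the samples; this is what makes
    the limit of the means deterministic. *)
Lemma mean_approx_near m f : poly_approx f ->
  forall e, 0 < e -> exists c, forall s', samples s' -> has_moments m s' ->
    \forall n \near \oo, `|c - mean f (s' n)| <= e.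
Proof.
move=> hf e e0; have e2 : 0 < e / 2 by exact: divr_gt0.
have [p hp] := hf _ e2.
exists (\sum_(i < size p) p`_i * m i) => s' ss' ms'.
have := @mean_poly_cvg m s' p ms' => /cvgrPdist_le/(_ _ e2); apply: filterS => n h.
have [sn s1] := ss' n.
rewrite (splitr e) -(subrKA (mean (horner p) (s' n))) (le_trans (ler_normD _ _))//.
rewrite lerD// distrC; apply: mean_approx; rewrite ?sn// => x xs.
by apply: hp; exact: s1.
Qed.

Lemma mean_approx_cvg m s f : samples s -> has_moments m s -> poly_approx f ->
  exists L : R, forall s', samples s' -> has_moments m s' ->
    mean f (s' n) @[n --> \oo] --> L.
Proof.
move=> ss ms hf.
have /cvg_ex[L sL] : cvg (mean f (s n) @[n --> \oo]).
  apply/cauchy_cvgP/cauchy_exP => e e0.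
  have e2 : 0 < e / 2 by exact: divr_gt0.
  have [c hc] := mean_approx_near m hf e2.
  exists c; have := hc _ ss ms; apply: filterS => n h.
  rewrite /ball/= (le_lt_trans h)//; lra.
exists L => s' ss' ms'; apply/cvgrPdist_le => e e0.
have e3 : 0 < e / 3 by exact: divr_gt0.
have [c hc] := mean_approx_near m hf e3.
move/cvgrPdist_le : sL => /(_ _ e3).
have := hc _ ss ms; have := hc _ ss' ms'.
apply: filterS3 => n.
rewrite !ler_norml => /andP[? ?] /andP[? ?] /andP[? ?]; apply/andP; split; lra.
Qed.

(** The default value 1 bounds all the samples of interest, so that the quantile
    function is nondecreasing on the whole real line and not only on [0, 1[. *)
Definition quantile l (t : R) : R :=
  nth 1 (sort <=%R l) (Num.truncn ((size l)%:R * t)).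

Lemma mean_sort f l : mean f (sort <=%R l) = mean f l.
Proof.
rewrite /mean size_sort; congr (_ * _).
by apply: perm_big; rewrite perm_sort.
Qed.

Lemma quantile_itv l t : (0 < size l)%N -> {in l, forall x, -1 <= x <= 1} ->
  -1 <= quantile l t <= 1.
Proof.
move=> l0 h; rewrite /quantile.
set i := Num.truncn _; have [il|il] := ltnP i (size l).
  by apply: h; rewrite -(mem_sort <=%R) mem_nth ?size_sort.
by rewrite nth_default ?size_sort//; lra.
Qed.

Lemma truncn_mul_lt (l : nat) (t : R) : (0 < l)%N -> 0 < t < 1 ->
  (Num.truncn (l%:R * t) < l)%N /\
  (Num.truncn (l%:R * t))%:R <= l%:R * t < (Num.truncn (l%:R * t)).+1%:R.
Proof.
move=> l0 /andP[t0 t1]; have h : 0 <= l%:R * t by rewrite mulr_ge0// ltW.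
have /andP[h1 h2] := truncn_itv h; split; last by rewrite h1.
rewrite -(ltr_nat R) (le_lt_trans h1)// -[ltRHS]mulr1 ltr_pM2l// ltr0n//.
Qed.

(** If the quantile of order t is below a, a proportion at least t of the samples
    is below a, and each of them contributes 1 to the mean of the ramp. *)
Lemma quantile_lt l a b t : (0 < size l)%N -> 0 < t < 1 -> a < b ->
  quantile l t < a -> t <= mean (ramp a b) l.
Proof.
move=> l0 t01 ab; have [kl /andP[kt tk]] := truncn_mul_lt l0 t01.
rewrite /quantile; set k := Num.truncn _ in kl kt tk *; set l' := sort _ _ => qa.
have l0' : 0 < (size l)%:R :> R by rewrite ltr0n.
rewrite -mean_sort /mean -/l' mulrC ler_pdivlMr ?size_sort// mulrC.
rewrite (le_trans (ltW tk))// (big_nth 1) size_sort big_mkord.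
apply: (@le_trans _ _ (\sum_(i < size l | (i < k.+1)%N) 1)).
  by rewrite -(big_ord_widen _ (fun=> 1)) // sumr_const card_ord.
rewrite big_mkcond; apply: ler_sum => i _; case: ifPn => ik.
  rewrite ramp_le// ltW// (le_lt_trans _ qa)//.
  apply: le_sorted_leq_nth; rewrite ?inE ?size_sort//.
  exact: sort_le_sorted.
by have /andP[] := ramp_itv (nth 1 l' i) ab.
Qed.

(** If the quantile of order t exceeds b, only a proportion at most t of the
    samples is below b, and the others contribute 0. *)
Lemma quantile_gt l a b t : (0 < size l)%N -> 0 < t < 1 -> a < b ->
  b < quantile l t -> mean (ramp a b) l <= t.
Proof.
move=> l0 t01 ab; have [kl /andP[kt tk]] := truncn_mul_lt l0 t01.
rewrite /quantile; set k := Num.truncn _ in kl kt tk *; set l' := sort _ _ => bq.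
have l0' : 0 < (size l)%:R :> R by rewrite ltr0n.
rewrite -mean_sort /mean -/l' mulrC ler_pdivrMr ?size_sort// mulrC.
rewrite (le_trans _ kt)// (big_nth 1) size_sort big_mkord.
apply: (@le_trans _ _ (\sum_(i < size l | (i < k)%N) 1)); last first.
  by rewrite -(big_ord_widen _ (fun=> 1)) ?(ltnW kl)// sumr_const card_ord.
rewrite [leRHS]big_mkcond; apply: ler_sum => i _; case: ifPn => ik.
  by have /andP[] := ramp_itv (nth 1 l' i) ab.
rewrite -leqNgt in ik; rewrite ramp_ge// ltW// (lt_le_trans bq)//.
apply: le_sorted_leq_nth; rewrite ?inE ?size_sort//.
exact: sort_le_sorted.
Qed.

Lemma quantile_nd l : {in l, forall x, x <= 1} -> nondecreasing_fun (quantile l).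
Proof.
move=> h t u tu; rewrite /quantile.
set i := Num.truncn _; set j := Num.truncn _.
have ij : (i <= j)%N by apply: le_truncn; rewrite ler_wpM2l.
have [jl|jl] := ltnP j (size l); last first.
  rewrite [leRHS]nth_default ?size_sort//.
  have [il|il] := ltnP i (size l); last by rewrite nth_default ?size_sort.
  by apply: h; rewrite -(mem_sort <=%R) mem_nth ?size_sort.
apply: le_sorted_leq_nth; rewrite ?inE ?size_sort// ?(leq_ltn_trans ij)//.
exact: sort_le_sorted.
Qed.

(** A level a belongs to the set when the limits of the ramps force the quantile
    of order t to be eventually at least a. Adding -1 and capping at 1 keep the
    supremum in [-1, 1] and monotone for every real t. *)
Definition limit_quantile (L : R -> R -> R) (t : R) : R :=
  sup [set a | a = -1 \/ (a <= 1 /\ exists2 b, a < b & L a b < t)].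

Section LimitQuantile.
Variable L : R -> R -> R.
Let S t := [set a | a = -1 \/ (a <= 1 /\ exists2 b, a < b & L a b < t)].

Let hsS t : has_sup (S t).
Proof. split; [by exists (-1); left|by exists 1 => a [->|[]//]; lra]. Qed.

Lemma limit_quantile_itv t : -1 <= limit_quantile L t <= 1.
Proof.
apply/andP; split; first by apply: ub_le_sup; [have [] := hsS t|left].
by apply: ge_sup; [have [] := hsS t|move=> a [->|[]//]; lra].
Qed.

Lemma limit_quantile_nd : nondecreasing_fun (limit_quantile L).
Proof.
move=> t u tu; apply: le_sup.
- move=> a aS; exists a; split=> //; case: aS => [->|[a1 [b ab Lt]]]; [by left|right].
  by split=> //; exists b => //; exact: lt_le_trans tu.
- by have [] := hsS t.
- exact: hsS.
Qed.

(** Below the limit the definition gives eventual lower bounds. Above it, choose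
    rationals a < b: a is not in the set, so L a b >= t, hence L a b > t, and the
    quantile is eventually at most b. *)
Lemma quantile_cvg s t : samples s ->
  (forall a b, a < b -> mean (ramp a b) (s n) @[n --> \oo] --> L a b) ->
  0 < t < 1 -> (forall a b : rat, L (ratr a) (ratr b) <> t) ->
  quantile (s n) t @[n --> \oo] --> limit_quantile L t.
Proof.
move=> ss sL t01 Lt; set q := limit_quantile L t.
have lo a : S t a -> \forall n \near \oo, a <= quantile (s n) t.
  case=> [->|[a1 [b ab Lab]]].
    apply: nearW => n; have [sn s1] := ss n.
    by have /andP[] := @quantile_itv (s n) t ltac:(by rewrite sn) s1.
  have := sL _ _ ab => /cvgr_lt/(_ _ Lab); apply: filterS => n h.
  rewrite leNgt; apply/negP => qa; have [sn _] := ss n.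
  by have := @quantile_lt (s n) a b t ltac:(by rewrite sn) t01 ab qa; rewrite leNgt h.
apply/cvgrPdist_le => e e0.
have hlo : \forall n \near \oo, q - e <= quantile (s n) t.
  have [a aS qa] := sup_adherent e0 (hsS t).
  by have := lo a aS; apply: filterS => n; apply: le_trans; exact: ltW.
have hhi : \forall n \near \oo, quantile (s n) t <= q + e.
  have [q1|q1] := leP 1 q.
    apply: nearW => n; have [sn s1] := ss n.
    have /andP[_ h] := @quantile_itv (s n) t ltac:(by rewrite sn) s1.
    by rewrite (le_trans h)// (le_trans q1)// lerDl ltW.
  have [|b] := @rat_in_itvoo R q (Num.min 1 (q + e)); first by rewrite lt_min q1 ltrDl.
  rewrite in_itv/= lt_min => /andP[qb /andP[b1 be]].
  have [a] := rat_in_itvoo qb; rewrite in_itv/= => /andP[qa ab].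
  have Lab : t < L (ratr a) (ratr b).
    rewrite lt_neqAle; apply/andP; split; first by apply/eqP => /esym; exact: Lt.
    rewrite leNgt; apply/negP => h; have : ratr a <= q.
      apply: ub_le_sup; first by have [] := hsS t.
      by right; split; [exact/ltW/(lt_trans ab)|exists (ratr b)].
    by rewrite leNgt qa.
  have := sL _ _ ab => /cvgr_gt/(_ _ Lab); apply: filterS => n h.
  rewrite (le_trans _ (ltW be))// leNgt; apply/negP => bq; have [sn _] := ss n.
  by have := @quantile_gt (s n) _ _ t ltac:(by rewrite sn) t01 ab bq; rewrite leNgt h.
near=> n; rewrite ler_norml; apply/andP; split.
- by rewrite lerNl opprB lerBlDl; near: n.
- by rewrite lerBlDl -lerBlDr; near: n.
Unshelve. all: end_near. Qed.

End LimitQuantile.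
End Mean.

(** * Couplings by quantile functions *)

Lemma powR_cvg0_seq (R : realType) (u : nat -> R) (r : R) : 0 < r ->
  (forall n, 0 <= u n) -> u n @[n --> \oo] --> 0 -> u n `^ r @[n --> \oo] --> 0.
Proof.
move=> r0 u0 cu; apply/cvgrPdist_le => e e0.
have d0 : 0 < e `^ r^-1 by rewrite powR_gt0.
move/cvgrPdist_le : cu => /(_ _ d0); apply: filterS => n.
rewrite !sub0r !normrN !ger0_norm ?powR_ge0// => h.
rewrite -[leRHS]powRr1 ?(ltW e0)// -(@mulVf _ r) ?gt_eqF// powRrM.
by apply: ge0_ler_powR; rewrite ?nnegrE ?powR_ge0// ltW.
Qed.

Section WassersteinBound.
Context (d : measure_display) (T : measurableType d) (R : realType) (P : probability T R).
Variables (X Y : T -> measurableTypeR R).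
Hypotheses (mX : measurable_fun setT X) (mY : measurable_fun setT Y).
Variables (mu nu : probability (measurableTypeR R) R).
Hypothesis lawX : forall A, measurable A -> P (X @^-1` A) = mu A.
Hypothesis lawY : forall A, measurable A -> P (Y @^-1` A) = nu A.

(** The joint law of X and Y is a coupling of mu and nu. *)
Lemma wasserstein_le (q : R) :
  (wasserstein q mu nu <= (\int[P]_t (`|X t - Y t| `^ q)%:E) `^ q^-1)%E.
Proof.
pose Z t := (X t, Y t).
have mZ : measurable_fun setT Z by exact: measurable_fun_pair.
pose Zm : {mfun T >-> (measurableTypeR R * measurableTypeR R)%type} :=
  HB.pack Z (isMeasurableFun.Build _ _ _ _ Z mZ).
apply: ereal_inf_lbound; exists (distribution P Zm).
  by move=> A mA; split; [exact: lawX|exact: lawY].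
congr (_ `^ _)%E; rewrite ge0_integral_distribution//.
  apply/measurable_EFinP.
  apply: (@measurableT_comp _ _ _ _ _ _ (fun x : R => x `^ q)) => //.
  apply: (@measurableT_comp _ _ _ _ _ _ (@Num.norm R R)) => //.
  by apply: measurable_funB.
Qed.

Lemma wasserstein_ge0 (q : R) : (0 <= wasserstein q mu nu)%E.
Proof. by apply: le_ereal_inf_tmp => _ [Pi _ <-]; exact: poweR_ge0. Qed.

End WassersteinBound.

Section WassersteinCvg.
Context (d : measure_display) (T : measurableType d) (R : realType) (P : probability T R).
Variables (X : nat -> T -> measurableTypeR R) (Y : T -> measurableTypeR R).
Hypotheses (mX : forall n, measurable_fun setT (X n)) (mY : measurable_fun setT Y).
Hypothesis X1 : forall n t, -1 <= (X n t : R) <= 1.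
Hypothesis Y1 : forall t, -1 <= (Y t : R) <= 1.
Hypothesis XY : {ae P, forall t, (X n t : R) @[n --> \oo] --> (Y t : R)}.

(** The integrands are bounded by 2^q, so almost sure convergence suffices. *)
Lemma Lq_cvg (q : R) : 0 < q ->
  ((\int[P]_t (`|X n t - Y t| `^ q)%:E) `^ q^-1)%E @[n --> \oo] --> 0%E.
Proof.
move=> q0; have mD n : measurable_fun setT (fun t => (`|X n t - Y t| `^ q)%:E).
  apply/measurable_EFinP.
  apply: (@measurableT_comp _ _ _ _ _ _ (fun x : R => x `^ q)) => //.
  apply: (@measurableT_comp _ _ _ _ _ _ (@Num.norm R R)) => //.
  by apply: (measurable_funB (mX n) mY).
have D2 n t : `|X n t - Y t| `^ q <= 2 `^ q.
  apply: ge0_ler_powR; rewrite ?nnegrE ?normr_ge0 ?(ltW q0)//.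
  by have /andP[? ?] := X1 n t; have /andP[? ?] := Y1 t; rewrite ler_norml; lra.
have cv : {ae P, forall t, setT t -> (`|X n t - Y t| `^ q)%:E @[n --> \oo] --> cst 0%E t}.
  apply: filterS XY => t h _; apply: cvg_EFin; first exact: nearW.
  apply: powR_cvg0_seq => //.
  rewrite -(normr0 R); apply: cvg_norm; rewrite -(subrr (Y t)).
  by apply: cvgB => //; exact: cvg_cst.
have I2 : P.-integrable setT (cst (2 `^ q)%:E) by exact: finite_measure_integrable_cst.
have dom : {ae P, forall t (n : nat), setT t ->
    (`|(`|X n t - Y t| `^ q)%:E| <= cst (2 `^ q)%:E t)%E}.
  by apply: aeW => t n _; rewrite /= lee_fin ger0_norm ?powR_ge0.
have [_ _] := @dominated_convergence _ T R P setT measurableT _ _ _ mD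
  (@measurable_cst _ _ _ _ setT 0%E) cv I2 dom.
rewrite integral0; set v := fun n => _ => cvv.
have v0 n : (0 <= v n)%E by apply: integral_ge0 => t _; rewrite lee_fin powR_ge0.
have vf n : v n \is a fin_num.
  rewrite ge0_fin_numE//; apply: (@le_lt_trans _ _ (\int[P]_t (2 `^ q)%:E)%E).
    by apply: ge0_le_integral => // t _; rewrite lee_fin ?powR_ge0.
  by rewrite integral_cst//= [X in (_ * X)%E](@probability_setT _ _ _ P) mule1 ltry.
rewrite (_ : (fun n => _) = fun n => (fine (v n) `^ q^-1)%:E); last first.
  by apply/funext => n; rewrite -/(v n) -poweR_EFin fineK.
apply: cvg_EFin; first exact: nearW.
apply: powR_cvg0_seq; rewrite ?invr_gt0//.
  by move=> n; rewrite fine_ge0.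
exact: (fine_cvg cvv).
Qed.

End WassersteinCvg.

Section UniformLaw.
Variable R : realType.
Local Notation U := (uniform_prob (@ltr01 R)).

Lemma uniform01E (A : set R) : measurable A -> U A = lebesgue_measure (A `&` `[0, 1]).
Proof.
move=> mA; rewrite /uniform_prob integral_uniform_pdf.
rewrite (eq_integral (cst 1%E)); first by rewrite integral_cst ?mul1e//; exact: measurableI.
by move=> x; rewrite inE => -[_]; rewrite /= in_itv/= /uniform_pdf subr0 invr1 => ->.
Qed.

Lemma uniform_countable (A : set R) : countable A -> {ae U, forall t, ~ A t}.
Proof.
move=> cA; exists A; split.
- exact: countable_measurable.
- rewrite uniform01E; last exact: countable_measurable.
  apply: countable_lebesgue_measure0; apply: sub_countable cA.
  by apply: subset_card_le; exact: subIsetl.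
- by move=> t /= /contrapT.
Qed.

Lemma uniform_ae_oo : {ae U, forall t, 0 < t < 1}.
Proof.
exists (~` `]0, 1[%classic); split.
- exact: measurableC.
- rewrite uniform01E; last exact: measurableC.
  apply: countable_lebesgue_measure0.
  apply: (@sub_countable _ _ _ [set 0; 1]); last exact: finite_set_countable.
  apply: subset_card_le => x [/=]; rewrite !in_itv/= => /negP h /andP[x0 x1].
  move: h; rewrite !lt_neqAle x0 x1 !andbT negb_and !negbK.
  by move=> /orP[/eqP|/eqP]; [left|right].
- by move=> t /= h; rewrite in_itv/=.
Qed.

Lemma measurable_quantile (l : seq R) : {in l, forall x, x <= 1} ->
  measurable_fun setT (quantile l).
Proof. by move=> h; apply: nondecreasing_measurable => //; exact: quantile_nd. Qed.

(** Induction on m: on [m / N, (m + 1) / N[ the quantile function is constant,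
    equal to the m-th smallest sample. *)
Lemma lebesgue_quantile_prefix (l : seq R) (A : set R) m :
  {in l, forall x, x <= 1} -> measurable A -> (m <= size l)%N -> (0 < size l)%N ->
  lebesgue_measure (quantile l @^-1` A `&` `[0, (size l)%:R^-1 * m%:R[) =
   ((size l)%:R^-1 * \sum_(k < m) \1_A (nth 1 (sort <=%R l) k))%:E.
Proof.
move=> l1 mA + l0; set N : R := (size l)%:R.
have N0 : 0 < N by rewrite ltr0n.
have mB : measurable (quantile l @^-1` A).
  by rewrite -[X in measurable X]setTI; exact: measurable_quantile.
elim: m => [|m IH] ml; first by rewrite big_ord0 !mulr0 set_itvco0 setI0 measure0.
set b := N^-1 * m%:R; have b0 : 0 <= b by rewrite mulr_ge0 ?invr_ge0// ltW.
have E : N^-1 * m.+1%:R = b + N^-1 by rewrite -[m.+1]addn1 natrD mulrDr mulr1.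
have iN0 : 0 < N^-1 by rewrite invr_gt0.
have -> : quantile l @^-1` A `&` `[0, N^-1 * m.+1%:R[ =
  (quantile l @^-1` A `&` `[0, b[) `|` (quantile l @^-1` A `&` `[b, b + N^-1[).
  rewrite -setIUr E; congr (_ `&` _); apply/seteqP; split=> t /=; rewrite !in_itv/=.
    by move=> /andP[t0 t1]; have [tb|bt] := ltP t b; [left; rewrite t0|right].
  by move=> [/andP[t0 tb]|/andP[bt tb]]; apply/andP; split; lra.
rewrite measureU; [|exact: measurableI|exact: measurableI|]; last first.
  apply/seteqP; split=> // t [[_ /=]]; rewrite in_itv/= => /andP[_ tb].
  by move=> [_]; rewrite in_itv/= leNgt tb.
rewrite big_ord_recr/= mulrDr EFinD -IH ?(ltnW ml)//; congr (_ + _)%E.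
have tr t : b <= t < b + N^-1 -> Num.truncn (N * t) = m.
  rewrite -E => /andP[bt tb]; apply/eqP; rewrite truncn_eq; last first.
    by rewrite mulr_ge0 ?(ltW N0)// (le_trans b0).
  by rewrite -ler_pdivrMl// -ltr_pdivlMl// bt tb.
rewrite indicE; case: (boolP (_ \in A)) => [|/negP]; rewrite inE => h.
  rewrite (_ : _ `&` _ = `[b, b + N^-1[%classic).
    rewrite lebesgue_measure_itv/= lte_fin ltrDl iN0 -EFinB mulr1.
    by congr (_%:E); ring.
  apply/seteqP; split=> t /=; first by case.
  by rewrite in_itv/= => bt; split=> //; rewrite /quantile -/N (tr _ bt).
rewrite (_ : _ `&` _ = set0) ?measure0 ?mulr0//.
apply/seteqP; split=> // t /= []; rewrite in_itv/= => At bt; apply: h.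
by move: At; rewrite /quantile -/N (tr _ bt).
Qed.

Lemma uniform_quantile (n : nat) (M : 'M[R]_n.+1) (A : set (measurableTypeR R)) :
  size (eigenvalues M) = n.+1 -> {in eigenvalues M, forall x, x <= 1} -> measurable A ->
  U (quantile (eigenvalues M) @^-1` A) = empirical_distribution M A.
Proof.
move=> sM M1 mA; set l := eigenvalues M in sM M1 *.
have l0 : (0 < size l)%N by rewrite sM.
have mB : measurable (quantile l @^-1` A).
  by rewrite -[X in measurable X]setTI; exact: measurable_quantile.
rewrite uniform01E//.
have := lebesgue_quantile_prefix M1 mA (leqnn _) l0.
rewrite mulVf ?gt_eqF ?ltr0n//.
set b := sort _ _; rewrite (_ : \sum_(k < size l) _ = \sum_(x <- l) \1_A x); last first.
  rewrite [RHS](perm_big b)/=; last by rewrite perm_sym perm_sort.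
  by rewrite (big_nth 1) size_sort big_mkord.
rewrite (big_nth 0) big_mkord sM => h.
rewrite /empirical_distribution /mscale /= -/l.
have -> : msum (fun k : nat => \d_((l`_k) : measurableTypeR R)) n.+1 A =
    \sum_(k < n.+1) (\1_A l`_k)%:E.
  by [].
rewrite sumEFin -EFinM -h.
have mI : measurable (quantile l @^-1` A `&` `[0, 1[) by exact: measurableI.
rewrite -(@setUitv1 _ _ (BLeft (0 : R)) 1 true) ?bnd_simp// setIUr measureU0//.
  by apply: measurableI => //; exact: measurable_set1.
apply: countable_lebesgue_measure0; apply: (@sub_countable _ _ _ [set 1]).
  by apply: subset_card_le; exact: subIsetr.
exact: finite_set_countable.
Qed.

End UniformLaw.

(** * Moments of the random spectrum *)

Section EnvMeasurability.
Variable R : realType.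

Lemma measurable_env_eval (i : int) :
  measurable_fun [set: env R] (fun e : env R => e i : 3.-tuple (measurableTypeR R)).
Proof.
move=> _ A mA; rewrite setTI; apply: sub_sigma_algebra.
by exists i => //; exists A => //; rewrite setTI.
Qed.

Lemma measurable_shift_env : measurable_fun [set: env R] (@shift_env R).
Proof.
apply: (@measurability _ _ (env R) (env R) setT (@shift_env R) (@cylinders R)) => //.
move=> _ [_ [i _ [A mA <-]] <-].
rewrite !setTI; have := @measurable_env_eval (i + 1) measurableT A mA.
by rewrite setTI.
Qed.

Lemma measurable_walk_step (i j : int) :
  measurable_fun [set: env R] (fun e : env R => walk_step e i j).
Proof.
have mk k : (k < 3)%N -> measurable_fun [set: env R] (fun e : env R => (e i)`_k : R).
  move=> k3; rewrite (_ : (fun e : env R => _) = (fun v : 3.-tuple (measurableTypeR R) =>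
      tnth v (Ordinal k3)) \o (fun e : env R => e i)).
    by apply: (measurableT_comp _ (measurable_env_eval i)); exact: measurable_tnth.
  by apply/funext => e /=; rewrite (tnth_nth 0).
rewrite /walk_step; case: (j == i - 1); first exact: mk.
case: (j == i); first exact: mk.
by case: (j == i + 1); first exact: mk.
Qed.

Lemma measurable_walk_law l (j : int) :
  measurable_fun [set: env R] (fun e : env R => walk_law e l j).
Proof.
elim: l j => [|l IH] j /=; first exact: measurable_cst.
apply: measurable_sum => i; apply: measurable_funM; first exact: IH.
exact: measurable_walk_step.
Qed.

End EnvMeasurability.

Lemma ae_distribution (d d' : measure_display) (T : measurableType d)
    (T' : measurableType d') (R : realType) (P : probability T R)
    (X : {mfun T >-> T'}) (G : T' -> Prop) :
  {ae distribution P X, forall y, G y} -> {ae P, forall w, G (X w)}.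
Proof.
move=> [N [mN N0 GN]]; exists (X @^-1` N); split => //.
- by rewrite -[X in measurable X]setTI; exact: measurable_funP.
- by move=> w /= Gw; apply: GN.
Qed.

Section Spectrum.
Context (R : realType) (d : measure_display) (Omega : measurableType d).
Variables (P : probability Omega R) (p : {RV P >-> env R}).
Hypothesis hp : ergodic_random_field p.

Let pL w i : Lambda3 (p w i). Proof. by have [h _ _] := hp; exact: h. Qed.

Let ret l : env R -> R := fun e => return_prob e l.

Let iret l : P.-integrable setT (EFin \o (ret l \o p)).
Proof.
apply: measurable_bounded_integrable => //.
- by rewrite (le_lt_trans (probability_le1 P measurableT))// ltry.
- by apply: (measurableT_comp (measurable_walk_law l 0)); exact: measurable_funP.
- exists 1; split => // x x1 w _ /=; have /andP[r0 r1] := return_prob_itv l (pL w).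
  by rewrite ger0_norm// (le_trans r1)// ltW.
Qed.

Let iretQ l : (distribution P p).-integrable setT (EFin \o ret l).
Proof.
apply: integrable_pushforward => //; last exact: iret.
by apply/measurable_EFinP; exact: measurable_walk_law.
Qed.

Definition limit_moment l : R := \int[distribution P p]_e (ret l e).

Lemma limit_momentE l :
  (limit_moment l)%:E = 'E_P[fun w => return_prob (p w) l]%E.
Proof.
rewrite /limit_moment /Rintegral fineK; last exact: (integrable_fin_num _ (iretQ l)).
rewrite unlock integral_distribution//.
  by apply/measurable_EFinP; exact: measurable_walk_law.
exact: iret.
Qed.

(** The trace sums the return probabilities at the sites 1 to n, whence the
    composition with one shift; the boundary costs at most 2l / n. *)
Lemma eigenvalue_moments :
  {ae P, forall w, has_moments limit_moment (fun n => eigenvalues (bd_kernel (p w) n.+1))}.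
Proof.
have [_ hst herg] := hp.
have birk l : {ae P, forall w,
    n.+1%:R^-1 * birkhoff_sum (@shift_env R) (ret l \o @shift_env R) n.+1 (p w)
      @[n --> \oo] --> limit_moment l}.
  pose G (e : env R) : Prop := n.+1%:R^-1 *
     birkhoff_sum (@shift_env R) (ret l \o @shift_env R) n.+1 e @[n --> \oo] --> limit_moment l.
  apply: (@ae_distribution _ _ _ _ _ P p G).
  have Is := integrable_comp_tau (@measurable_shift_env R) hst (iretQ l).
  have := @birkhoff _ (env R) R (distribution P p) (@shift_env R)
    (@measurable_shift_env R) hst herg _ Is.
  by rewrite (Rintegral_comp_tau (@measurable_shift_env R) hst (iretQ l)).
have := ae_foralln birk; apply: filterS => w h l.
have {}h := h l; set b := fun n => _ in h.
rewrite (_ : (fun n => _) = fun n => b n +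
   (mean (fun x => x ^+ l) (eigenvalues (bd_kernel (p w) n.+1)) - b n)); last first.
  by apply/funext => n; rewrite addrC subrK.
rewrite -[limit_moment l]addr0; apply: cvgD; first exact: h.
have c0 (c : R) : c * harmonic n @[n --> \oo] --> 0.
  by rewrite -(mulr0 c); apply: cvgMl_tmp; exact: cvg_harmonic.
apply: (@squeeze_cvgr _ _ _ _ (fun n => - (2 * l)%:R * harmonic n)
  (fun n => (2 * l)%:R * harmonic n)) (c0 _) (c0 _).
apply: nearW => n; have [sK _ tK] := bd_kernel_spectrum n (pL w).
rewrite mulNr -ler_norml /b /mean sK tK -mulrBr normrM gtr0_norm ?invr_gt0//.
rewrite mulrC /harmonic/= ler_pM2r ?invr_gt0//.
exact: (trace_return_prob l n.+1 (pL w)).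
Qed.

Lemma eigenvalue_samples w : samples (fun n => eigenvalues (bd_kernel (p w) n.+1)).
Proof. by move=> n; have [sK K1 _] := bd_kernel_spectrum n (pL w). Qed.

End Spectrum.

Section QuantileMoment.
Variable R : realType.
Local Notation U := (uniform_prob (@ltr01 R)).

(** Change of variables to the empirical distribution, a finite sum of Dirac
    masses concentrated on [-1, 1]. *)
Lemma integral_quantile (n : nat) (M : 'M[R]_n.+1) (h : R -> R) :
  size (eigenvalues M) = n.+1 -> {in eigenvalues M, forall x, -1 <= x <= 1} ->
  measurable_fun setT h -> (forall x, -1 <= x <= 1 -> 0 <= h x) ->
  (\int[U]_t (h (quantile (eigenvalues M) t))%:E = (mean h (eigenvalues M))%:E)%E.
Proof.
move=> sM M1 mh h0; set l := eigenvalues M in sM M1 *.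
have l1 : {in l, forall x, x <= 1} by move=> x /M1/andP[].
have mq : measurable_fun setT (quantile l) by exact: measurable_quantile.
pose D : set (measurableTypeR R) := `[-1, 1]%classic.
have mD : measurable D by exact: measurable_itv.
have hD x : D x -> (0 <= (h x)%:E)%E by rewrite /D/= in_itv/= lee_fin => /h0.
have mhD : measurable_fun D (EFin \o h).
  by apply: measurable_funTS; exact/measurable_EFinP.
transitivity (\int[pushforward U (quantile l : measurableTypeR R -> measurableTypeR R)]_(x
    in D) (h x)%:E)%E.
  rewrite ge0_integral_pushforward//; last by move=> x; rewrite inE => /hD.
  rewrite (_ : quantile l @^-1` D = setT)//.
  apply/seteqP; split=> // t _ /=; rewrite /D/= in_itv/=.
  by apply: quantile_itv => //; rewrite sM.
rewrite (eq_measure_integral (empirical_distribution M)); last first.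
  by move=> A mA _; exact: uniform_quantile.
rewrite ge0_integral_mscale//= ge0_integral_measure_sum//.
have Dl k : (k < n.+1)%N -> D l`_k.
  by move=> kn; rewrite /D/= in_itv/=; apply: M1; rewrite mem_nth ?sM.
rewrite (eq_bigr (fun k : 'I_n.+1 => (h l`_k)%:E)); last first.
  by move=> k _; rewrite integral_dirac// diracE mem_set ?mul1e//; exact: Dl.
by rewrite sumEFin -EFinM /mean [in RHS](big_nth 0) [in RHS]big_mkord sM.
Qed.

End QuantileMoment.

(** * The limiting spectral distribution *)

(** The exceptional orders t are the values of L at pairs of rationals, a countable
    set. *)
Lemma limit_quantile_ae (R : realType) (L : R -> R -> R) (s : nat -> seq R) :
  samples s -> (forall a b, mean (ramp a b) (s n) @[n --> \oo] --> L a b) ->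
  {ae uniform_prob (@ltr01 R), forall t,
    quantile (s n) t @[n --> \oo] --> limit_quantile L t}.
Proof.
move=> ss sL; pose N := range (fun ab : rat * rat => L (ratr ab.1) (ratr ab.2)).
have cN : countable N by apply: (sub_countable (card_image_le _ _)); exact: countableP.
have FU := ae_filter_ringOfSetsType (uniform_prob (@ltr01 R)).
apply: filterS2 (uniform_ae_oo R) (uniform_countable cN) => t t01 Nt.
apply: quantile_cvg => // a b Lab; apply: Nt; by exists (a, b).
Qed.

Theorem theorem1p6 (R : realType) (d : measure_display)
    (Omega : measurableType d) (P : probability Omega R)
    (p : {RV P >-> env R}) (hp : ergodic_random_field p) :
  exists mu : probability (measurableTypeR R) R,
    [/\ mu `[-1, 1]%classic = 1%E,
        {ae P, forall w, forall q : R, 1 <= q ->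
          wasserstein q (empirical_distribution (bd_kernel (p w) n.+1)) mu
            @[n --> \oo] --> 0%E} &
        forall l : nat,
          (\int[mu]_(x in `[(-1)%R, 1%R]%classic) (x ^+ l)%:E = 'E_P[fun w => return_prob (p w) l])%E].
Proof.
pose U := uniform_prob (@ltr01 R).
pose s w n := eigenvalues (bd_kernel (p w) n.+1).
have ss w : samples (s w) by exact: eigenvalue_samples.
have ms := eigenvalue_moments hp.
have [w0 m0] : exists w, has_moments (limit_moment p) (s w).
  have P0 : (0 < P setT)%E by rewrite (@probability_setT _ _ _ P).
  exact: (@filter_ex _ _ (ae_properfilter_algebraOfSetsType P0) _ ms).
(* The limits found along one good environment serve for all good ones. *)
have [L hL] : exists L : R -> R -> R, forall a b s', samples s' ->
    has_moments (limit_moment p) s' -> mean (ramp a b) (s' n) @[n --> \oo] --> L a b.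
  have /choice[L hL] : forall ab : R * R, exists c : R, forall s', samples s' ->
      has_moments (limit_moment p) s' -> mean (ramp ab.1 ab.2) (s' n) @[n --> \oo] --> c.
    by move=> [a b]; exact: mean_approx_cvg (ss w0) m0 (poly_approx_ramp a b).
  by exists (fun a b => L (a, b)) => a b; exact: (hL (a, b)).
pose Q : measurableTypeR R -> measurableTypeR R := limit_quantile L.
have mQ : measurable_fun setT Q.
  by apply: nondecreasing_measurable => //; exact: limit_quantile_nd.
have Q1 t : -1 <= Q t <= 1 by exact: limit_quantile_itv.
have sl w n : size (s w n) = n.+1 by have [] := ss w n.
have s1 w n : {in s w n, forall x, -1 <= x <= 1} by have [] := ss w n.
have s1' w n : {in s w n, forall x, x <= 1} by move=> x /s1/andP[].
have mq w n : measurable_fun setT (quantile (s w n)) by exact: measurable_quantile.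
have q1 w n t : -1 <= quantile (s w n) t <= 1 by apply: quantile_itv; rewrite ?sl.
have qQ w : has_moments (limit_moment p) (s w) ->
    {ae U, forall t, quantile (s w n) t @[n --> \oo] --> Q t}.
  by move=> mw; apply: limit_quantile_ae => // a b; exact: hL.
pose Qm : {mfun measurableTypeR R >-> measurableTypeR R} :=
  HB.pack Q (isMeasurableFun.Build _ _ _ _ Q mQ).
exists (distribution U Qm); have QD : Q @^-1` `[-1, 1] = setT.
  by apply/seteqP; split => // t _ /=; rewrite in_itv/=; exact: Q1.
split.
- by rewrite /distribution/pushforward/= QD; exact: probability_setT.
- apply: filterS ms => w mw q q1'.
  have q0 : 0 < q by lra.
  pose X n : measurableTypeR R -> measurableTypeR R := quantile (s w n).
  have := @Lq_cvg _ _ R U X Q (mq w) mQ (q1 w) Q1 (qQ w mw) q q0.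
  apply: squeeze_cvge; last exact: cvg_cst.
  apply: nearW => n; rewrite wasserstein_ge0/=.
  apply: (@wasserstein_le _ _ R U (X n) Q (mq w n) mQ) => // A mA.
  by apply: uniform_quantile => //; [exact: sl|exact: s1'].
- move=> l; rewrite -(limit_momentE hp).
  (* Adding 1 makes the integrand nonnegative on [-1, 1]. *)
  have mX (f : R -> R) : measurable_fun setT f -> measurable_fun setT (fun t => 1 + f t ^+ l).
    by move=> mf; apply: measurable_funD => //; exact: measurable_funX.
  have X2 (f : R -> R) t : -1 <= f t <= 1 -> `|1 + f t ^+ l| <= 2.
    rewrite -ler_norml => ft; rewrite (le_trans (ler_normD _ _))// normr1 normrX.
    by rewrite -[leRHS]/(1 + 1) lerD2l exprn_ile1.
  have cv : {ae U, forall t, setT t ->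
      (1 + quantile (s w0 n) t ^+ l)%:E @[n --> \oo] --> (1 + Q t ^+ l)%:E}.
    have FU := ae_filter_ringOfSetsType U.
    apply: filterS (qQ w0 m0) => t h _; apply: cvg_EFin; first exact: nearW.
    by apply: cvgD; [exact: cvg_cst|exact: (continuous_cvg _ (@exprn_continuous R l _) h)].
  have I2 : U.-integrable setT (cst 2%:E) by exact: finite_measure_integrable_cst.
  have dom : {ae U, forall t (n : nat), setT t ->
      (`|(1 + quantile (s w0 n) t ^+ l)%:E| <= cst 2%:E t)%E}.
    by apply: aeW => t n _; rewrite /= lee_fin; exact: X2.
  have mE (f : R -> R) : measurable_fun setT f -> measurable_fun setT (fun t => (1 + f t ^+ l)%:E).
    by move=> mf; apply/measurable_EFinP; exact: mX.
  have [IQ _ cvI] := @dominated_convergence _ _ R U setT measurableT _ _ _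
    (fun n => mE _ (mq w0 n)) (mE _ mQ) cv I2 dom.
  have int_eq : (\int[U]_t (1 + Q t ^+ l)%:E = (1 + limit_moment p l)%:E)%E.
    have cvm : (1 + mean (fun x => x ^+ l) (s w0 n))%:E @[n --> \oo] -->
        (1 + limit_moment p l)%:E.
      apply: cvg_EFin; first exact: nearW.
      by apply: cvgD; [exact: cvg_cst|exact: m0].
    move: cvI; rewrite [X in X @ _](_ : _ =
      fun n => (1 + mean (fun x => x ^+ l) (s w0 n))%:E) => [cvI|].
      exact: (cvg_unique _ cvI cvm).
    apply/funext => n; rewrite /= (integral_quantile (h := fun x => 1 + x ^+ l)).
    + congr (_%:E); rewrite /mean big_split/= mulrDr; congr (_ + _).
      rewrite big_const_seq count_predT iter_addr addr0 -/(s w0 n) sl.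
      by rewrite -[1 *+ _]/(n.+1%:R) mulVf.
    + exact: sl.
    + exact: s1.
    + exact: mX.
    + move=> x; rewrite -ler_norml => x1; rewrite -lerBlDl add0r.
      have : `|x ^+ l| <= 1 by rewrite normrX exprn_ile1.
      by rewrite ler_norml => /andP[].
  have IQl : U.-integrable setT (fun t => (Q t ^+ l)%:E).
    have I1 : U.-integrable setT (cst 1%:E) by exact: finite_measure_integrable_cst.
    have := integrableB measurableT IQ I1; congr (U.-integrable _ _).
    by apply/funext => t; rewrite /= -EFinB addrC addKr.
  have -> : (\int[distribution U Qm]_(x in `[(-1)%R, 1%R]%classic) (x ^+ l)%:E =
    \int[U]_t (Q t ^+ l)%:E)%E.
    rewrite /distribution (@integral_pushforward _ _ _ _ _ _ mQ U _ (fun x => (x ^+ l)%:E)).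
    + by rewrite QD.
    + by apply/measurable_EFinP; exact: measurable_funX.
    + by rewrite QD.
    + exact: measurable_itv.
  have int1 : (\int[U]_t (EFin \o cst 1%R) t = 1%:E)%E.
    rewrite (_ : EFin \o cst (1 : R) = cst 1%:E)// integral_cst//.
    by rewrite [X in (_ * X)%E](@probability_setT _ _ _ U) mule1.
  have I1 : U.-integrable setT (cst 1%:E) by exact: finite_measure_integrable_cst.
  move: int_eq; rewrite (@integralD_EFin _ _ _ U setT measurableT (cst 1) (fun t => Q t ^+ l))//.
  rewrite int1.
  rewrite -(fineK (integrable_fin_num measurableT IQl)) -EFinD => -[] /addrI h.
  by rewrite h.
Qed.
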